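(* In the setting described in the context (analytic setting, stochastic setting, and operators $P$, $G$, $LAP$), assume the following four conditions. (E1) $(S,D)$ is essentially selfadjoint on $H$ and there is a constant $\Lambda_m>0$ with $-(Sf,f)_H\ge \Lambda_m\|(I-P)f\|^2$ for all $f\in D$. (E2) The technical condition holds, i.e. $P(D)\subset \overline{D}^A$, $AP(D)\subset \overline{D}^A\cap\overline{D}^S\cap\overline{D}^L$ and $L=S-A$ on $AP(D)$; and there are constants $c_1,c_2\in[0,\infty)$ with $\|LAPf\|\le c_1\|Gf\|+c_2\|f\|$ for all $f\in D_P$. (E3) $(G,D_P)$ is essentially selfadjoint on $H_P$; there is a constant $\Lambda_M>0$ with $-(Gf,f)_H\ge \Lambda_M\|f-(f,1)_H\|^2$ for all $f\in D_P$; and $1\in H_P$, $1\in\overline{D_P}^G$ and $G1=0$. (E4) There is $c_3\ge0$ such that $(SAPf,APf)_H=c_3\,(Gf,f)_H$ for all $f\in D_P$. Then for every $f\in L^2(E,\mu)$ and every $t>0$, $$\left\|\frac1t\int_0^t f(X_s)\,ds-\mathbb{E}_\mu[f]\right\|_{L^2(\mathbb{P})}\le \sqrt2\left(\frac1t\,\kappa_1+\frac{1}{\sqrt t}\,\kappa_2\right)\left\|f(X_0)-\mathbb{E}_\mu[f]\right\|_{L^2(\mathbb{P})},$$ where $\mathbb{E}_\mu[f]=\int_E f\,d\mu$ and $$\kappa_1=\frac{\sqrt2}{\sqrt{\Lambda_M}},\qquad \kappa_2=\frac{c_1+1}{\sqrt{\Lambda_m}}+\frac{c_2}{\sqrt{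\Lambda_m}\,\Lambda_M}+\frac{\sqrt{c_3}}{\sqrt{\Lambda_M}}\,.$$
   Context: Analytic setting. $E$ is a separable metric space with Borel $\sigma$-algebra $\mathcal{B}(E)$, $\mu$ is a probability measure on $(E,\mathcal{B}(E))$ and $H=L^2(E,\mu)$ with scalar product $(\cdot,\cdot)_H$ and norm $\|\cdot\|_H=\|\cdot\|$ (real-valued functions). $D\subset H$ is a dense linear subspace which is an algebra. $(S,D)$ is a symmetric nonpositive definite linear operator on $H$ and $(A,D)$ is an antisymmetric linear operator on $H$; $L:=S-A$ and $\hat L:=S+A$ on $D$. The measure $\mu$ is invariant: $\int_E Lf\,d\mu=0=\int_E\hat Lf\,d\mu$ for all $f\in D$. The operators with domain $D$ are closable and their closures on $H$ are denoted $(L,\overline{D}^L)$, $(\hat L,\overline{D}^{\hat L})$, $(S,\overline{D}^S)$, $(A,\overline{D}^A)$. $P\colon H\to\mathcal{N}(S)$ is the orthogonal projection onto the kernel $\mathcal{N}(S)$ of $(S,\overline{D}^S)$. $1$ denotes the constant function. Stochastic setting. $C([0,\infty);E)$ is the space of continuous paths in $E$, $X_t$ is the evaluation of paths at time $t$, $\mathcal{F}^0_t=\sigma(X_s: 0\le s\le t)$. A probability law is a probability measure on $C([0,\infty);E)$ equipped with $\sigma(X_s:s\ge0)$. A law $\mathbb{P}$ has invariant measure $\mu$ if $\mathbb{P}\circ X_t^{-1}=\mu$ for all $t\ge0$. $\mathbb{P}_T$ is the image of $\mathbb{P}$ under restriction of paths to $C([0,T];E)$ and $\tau_T((\omega_s)_{s\in[0,T]})=(\omega_{T-s})_{s\in[0,T]}$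 is time reversal. For $f\in D$ put $\Gamma_L(f,f)=\frac12(L(f^2)-2fLf)$, $$M^{[f],L}_t=f(X_t)-f(X_0)-\int_0^tLf(X_s)\,ds,\qquad N^{[f],L}_t=\big(M^{[f],L}_t\big)^2-2\int_0^t\Gamma_L(f,f)(X_s)\,ds,\quad t\ge0,$$ and analogously with $\hat L$ in place of $L$. (Under a law with invariant measure $\mu$, for $g\in L^1(\mu)$ the variables $g(X_t)$ and $\int_0^tg(X_s)\,ds$ are a.s. independent of the $\mu$-version of $g$.) Assumed: $\mathbb{P}$ and $\hat{\mathbb{P}}$ are probability laws on $C([0,\infty);E)$ with invariant measure $\mu$ such that $\hat{\mathbb{P}}_T=\mathbb{P}_T\circ\tau_T^{-1}$ for all $T\ge0$, and for all $f\in D$, $N^{[f],L}$ is an $(\mathcal{F}^0_t)_{t\ge0}$-martingale under $\mathbb{P}$ and $N^{[f],\hat L}$ is an $(\mathcal{F}^0_t)_{t\ge0}$-martingale under $\hat{\mathbb{P}}$. Further operators (under the technical condition). $D_P:=P(D)$; $H_P:=P(H)$ is a Hilbert space with the scalar product of $H$. $G\colon D_P\to H_P$ is $G:=PA^2P$ (i.e. $Gf=PA^2Pg$ for $f=Pg$, $g\in D$), and $(G,\overline{D_P}^G)$ is its closure on $H_P$. $LAP\colon D_P\to H$ is given by $LAPf=LAPg$ for $f=Pg$, $g\in D$. *)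

(* Defs.v *)
From HB Require Import structures.
From mathcomp Require Import all_boot all_order all_algebra.
From mathcomp Require Import all_classical all_reals all_analysis.

Set Implicit Arguments.
Unset Strict Implicit.
Unset Printing Implicit Defensive.

Import Order.TTheory GRing.Theory Num.Theory.
Import numFieldNormedType.Exports.

Local Open Scope classical_set_scope.
Local Open Scope ring_scope.

(* The library's measurable types are pointed; this only excludes the empty
   space, which carries no probability measure anyway. *)
#[short(type="pmetricType")]
HB.structure Definition PMetric (K : numDomainType) :=
  {M of Pointed M & Metric K M}.

Definition separable_space (T : topologicalType) :=
  exists2 Q : set T, countable Q & dense Q.

Notation borelType E := (g_sigma_algebraType (@open E)).

(* The elements of L2 mu are square-integrable Borel functions; two of them are
   the same element of the Hilbert space H when they agree mu-a.e. (=L2).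
   Subsets of H are therefore sets of functions stable under =L2. *)
Notation L2 mu := (LfunType mu (lee1n 2)).

Section L2_space.
Context {d : measure_display} {T : measurableType d} {R : realType}.
Variable mu : probability T R.
Implicit Types (f g : L2 mu) (K D : set (L2 mu)).

Definition eqL2 f g := (f : T -> R) = (g : T -> R) %[ae mu].

Definition inner f g : R := \int[mu]_x (f x * g x).

Definition normL2 f : R := fine ('N[mu]_2%:E[EFin \o f])%E.

(* f seen as an element of H; junk value 0 when f is not square-integrable *)
Definition toL2 (f : T -> R) : L2 mu := insubd 0 f.

Definition oneL2 : L2 mu := toL2 (cst 1).

Definition stableL2 D := forall f g, D f -> eqL2 f g -> D g.

Definition linear_subspace D :=
  [/\ stableL2 D, D 0 & forall (a : R) f g, D f -> D g -> D (a *: f + g)].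

Definition subalgebra D := forall f g, D f -> D g ->
  (f : T -> R) \* g \in Lfun mu 2%:E /\ D (toL2 ((f : T -> R) \* g)).

Definition dense_in K D :=
  D `<=` K /\
  forall f, K f -> forall e : R, 0 < e -> exists2 g, D g & normL2 (f - g) < e.

Definition is_orth_proj K (P : L2 mu -> L2 mu) :=
  forall f, K (P f) /\ forall g, K g -> inner (f - P f) g = 0.

Definition imageL2 (P : L2 mu -> L2 mu) D : set (L2 mu) :=
  [set h | exists2 g, D g & eqL2 h (P g)].

(* A linear operator with domain D, given by a function only relevant on D. *)
Definition linear_on D (T0 : L2 mu -> L2 mu) :=
  (forall f g, D f -> eqL2 f g -> eqL2 (T0 f) (T0 g)) /\
  (forall (a : R) f g, D f -> D g ->
     eqL2 (T0 (a *: f + g)) (a *: T0 f + T0 g)).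

(* Unbounded operators are handled through their graphs:
   U f g reads "f is in the domain of U and U f = g". *)
Definition operator := L2 mu -> L2 mu -> Prop.
Implicit Types U V : operator.

Definition oper D (T0 : L2 mu -> L2 mu) : operator :=
  fun f g => D f /\ eqL2 g (T0 f).

Definition op_dom U : set (L2 mu) := [set f | exists g, U f g].

Definition op_ker U : set (L2 mu) := [set f | U f 0].

Definition op_image U D : set (L2 mu) := [set h | exists2 g, D g & U g h].

Definition op_comp U V : operator := fun f h => exists2 g, V f g & U g h.

Definition op_restr K U : operator := fun f g => K f /\ U f g.

(* Closure of the graph. For an operator acting in a closed subspace of H
   this is also its closure within that subspace. *)
Definition closure_op U : operator := fun f g =>
  exists u v : nat -> L2 mu,
    [/\ forall n, U (u n) (v n),
        (fun n => normL2 (u n - f)) @ \oo --> (0 : R) &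
        (fun n => normL2 (v n - g)) @ \oo --> (0 : R)].

Definition closable U := forall g, closure_op U 0 g -> eqL2 g 0.

(* Adjoint, and selfadjointness, in the Hilbert space K (a closed subspace). *)
Definition adjoint_in K U : operator := fun g h =>
  [/\ K g, K h & forall f k, U f k -> inner k g = inner f h].

Definition selfadjoint_in K U :=
  dense_in K (op_dom U) /\ forall f g, U f g <-> adjoint_in K U f g.

Definition essentially_selfadjoint_in K U := selfadjoint_in K (closure_op U).

End L2_space.

Section path_space.
Context {R : realType}.

HB.instance Definition _ (I : set R) (E : pmetricType R) :=
  isPointed.Build (continuousType I E) (cst point).

(* generators of the sigma-algebra of the coordinates with index in J *)
Definition cylinders (I : set R) (E : pmetricType R) (J : set I) :
    set (set (continuousType I E)) :=
  [set A | exists s, exists2 B : set (borelType E),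
     J s & measurable B /\ A = (fun w : continuousType I E => w s) @^-1` B].

End path_space.

(* C(I; E) with the sigma-algebra generated by all coordinates *)
Notation pathType I E := (g_sigma_algebraType (@cylinders _ I E setT)).

Definition half_line (R : realType) : set R := `[0, +oo[%classic.
Arguments half_line : clear implicits.
Definition segment (R : realType) (T : R) : set R := `[0, T]%classic.
Arguments segment {R} T _.

Section coordinates.
Context {R : realType} {E : pmetricType R}.

Lemma to_time_subproof (t : R) : Num.max 0 t \in half_line R.
Proof.
by apply/mem_set; rewrite /half_line/= in_itv/= andbT le_max lexx.
Qed.

Definition to_time (t : R) : set_type (half_line R) :=
  exist (fun s => s \in half_line R) _ (to_time_subproof t).

(* X_t, for t >= 0 (and X_0 for t < 0) *)
Definition path_at (t : R) (w : pathType (half_line R) E) : borelType E :=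
  (w : continuousType (half_line R) E) (to_time t).

(* F^0_t = sigma(X_s : 0 <= s <= t) *)
Definition path_filtration (t : R) : set (set (pathType (half_line R) E)) :=
  <<s @cylinders R (half_line R) E [set s | \val s <= t] >>.

Section restriction_reversal.
Variable T : R.

Lemma segment_incl_subproof (s : set_type (segment T)) : \val s \in half_line R.
Proof.
case: s => s /= /set_mem; rewrite /segment/= in_itv/= => /andP[s0 _].
by apply/mem_set; rewrite /half_line/= in_itv/= s0.
Qed.

Definition segment_incl (s : set_type (segment T)) : set_type (half_line R) :=
  exist (fun s => s \in half_line R) _ (segment_incl_subproof s).

Lemma segment_rev_subproof (s : set_type (segment T)) : T - \val s \in segment T.
Proof.
case: s => s /= /set_mem; rewrite /segment/= in_itv/= => /andP[s0 sT].
by apply/mem_set; rewrite /segment/= in_itv/= subr_ge0 sT gerBl.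
Qed.

Definition segment_rev (s : set_type (segment T)) : set_type (segment T) :=
  exist (fun s => s \in segment T) _ (segment_rev_subproof s).

Lemma continuous_segment_incl : continuous segment_incl.
Proof.
apply: (@continuous_comp_initial (set_type (half_line R))
  (set_type (segment T)) R set_val segment_incl).
exact: (@initial_continuous (set_type (segment T)) R set_val).
Qed.

Lemma continuous_segment_rev : continuous segment_rev.
Proof.
apply: (@continuous_comp_initial (set_type (segment T))
  (set_type (segment T)) R set_val segment_rev).
move=> x; apply: (@continuous_comp _ _ _ set_val (fun r => T - r)).
  exact: (@initial_continuous (set_type (segment T)) R set_val).
by apply: (@continuousB R R^o); [exact: cst_continuous|exact: cvg_id].
Qed.

HB.instance Definition _ := isContinuous.Build _ _ segment_incl continuous_segment_incl.
HB.instance Definition _ := isContinuous.Build _ _ segment_rev continuous_segment_rev.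

(* restriction of paths to [0, T] *)
Definition restr (w : pathType (half_line R) E) : pathType (segment T) E :=
  ((w : continuousType (half_line R) E) \o segment_incl : continuousType _ _).

(* time reversal tau_T *)
Definition reversal (w : pathType (segment T) E) :
    pathType (segment T) E :=
  ((w : continuousType (segment T) E) \o segment_rev : continuousType _ _).

End restriction_reversal.

End coordinates.

Section stochastic.
Context {R : realType}.

(* The defining property of E[M_t | F_s] = M_s is spelled out. *)
Definition martingale d (W : measurableType d) (P : probability W R)
    (F : R -> set (set W)) (M : R -> W -> R) :=
  forall t : R, 0 <= t ->
    [/\ forall B : set R, measurable B -> F t (M t @^-1` B),
        P.-integrable setT (EFin \o M t) &
        forall s : R, 0 <= s <= t -> forall A, F s A ->
          \int[P]_(w in A) M t w = \int[P]_(w in A) M s w].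

Context {E : pmetricType R} (mu : probability (borelType E) R).

Definition has_invariant_measure (P : probability (pathType (half_line R) E) R) :=
  forall t : R, 0 <= t -> forall B : set (borelType E), measurable B ->
    pushforward P (path_at t) B = mu B.

(* Phat_T = P_T o tau_T^-1 *)
Definition reversed_laws (Phat P : probability (pathType (half_line R) E) R) :=
  forall T : R, 0 <= T -> forall B : set (pathType (segment T) E),
    measurable B ->
    pushforward Phat (@restr R E T) B =
    pushforward P (@reversal R E T \o @restr R E T) B.

Variable L : L2 mu -> L2 mu.

(* Gamma_L(f, f); meaningful when f^2 belongs to the domain of L *)
Definition Gamma (f : L2 mu) (x : E) : R :=
  2^-1 * (L (toL2 mu (fun y => f y ^+ 2)) x - 2 * f x * L f x).

(* time integrals of Borel functions along a path *)
Definition time_int (g : E -> R) (t : R) (w : pathType (half_line R) E) : R :=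
  \int[lebesgue_measure]_(s in `[0, t]) g (path_at s w).

Definition Mproc (f : L2 mu) (t : R) (w : pathType (half_line R) E) : R :=
  f (path_at t w) - f (path_at 0 w) - time_int (L f) t w.

Definition Nproc (f : L2 mu) (t : R) (w : pathType (half_line R) E) : R :=
  Mproc f t w ^+ 2 - 2 * time_int (Gamma f) t w.

End stochastic.

(* Main.v *)
Require Import Defs.
From HB Require Import structures.
From mathcomp Require Import all_boot all_order all_algebra.
From mathcomp Require Import all_classical all_reals all_analysis.
From mathcomp Require Import measurable_realfun ring lra.

(* Idea. Write p(g) for the L2(P)-norm of int_0^t g(X_s) ds, a seminorm with
   p(g) <= t |g|. The martingale property gives |M_t^[f]|^2 = 2t (-(Sf, f)) for
   L under P, and likewise for hat L under hat P. Reversing time and adding the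
   forward and backward martingales yields p(Sf) <= sqrt(2t) sqrt(-(Sf, f)),
   while the forward one alone yields p(Lf) <= 2 |f| + sqrt(2t) sqrt(-(Sf, f)).
   Both pass to the closures. Since S is essentially selfadjoint, its range is
   dense in N(S)^perp, so (E1) gives p(g - Pg) <= sqrt(2t / Lambda_m) |g - Pg|.
   Likewise the range of G is dense in the mean-zero part of H_P, and for
   k = Gh and u = APh one has k = - PLu = - Lu + (1 - P)Lu; p(Lu) is controlled
   by |u|^2 = -(Gh, h) and (E4), p((1 - P)Lu) by the first bound and (E2). *)

(** [S] is coercive only away from its kernel; on the kernel decay can come only through [A], and
    [G] records it. Hence a centred [f] is split into [f - P f] and [P f]. A forward martingale
    alone leaves the boundary term [f(X_t) - f(X_0)] in every bound. Reversal removes it on the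
    range of [S], so [f - P f] contributes only at order [1 / sqrt t]; the boundary term kept for
    [u] is the sole origin of [kappa1], through [2 |u| <= 2 |k| / sqrt Lambda_M]. In [kappa2] the
    summand 1 is the cost of [f - P f], [c1] and [c2] that of [(1 - P)Lu], and [sqrt c3] that of the
    martingale attached to [u]. The bound on [|Lu|] also contains [|h|], which the spectral gap of
    [G] controls only after centring [h]; since 1 is known to lie only in the domain of the closure
    of [G], centring goes through a limit. The operator argument sees the process only through the
    seminorm [p]. *)

Set Implicit Arguments.
Unset Strict Implicit.
Unset Printing Implicit Defensive.

Import Order.TTheory GRing.Theory Num.Theory.
Import numFieldNormedType.Exports.

Local Open Scope classical_set_scope.
Local Open Scope ring_scope.

(** * The inner product of L2 *)

Section L2_theory.
Context {d : measure_display} {T : measurableType d} {R : realType}.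
Variable mu : probability T R.
Implicit Types (f g h : L2 mu).

Lemma measurable_L2 f : measurable_fun setT (f : T -> R).
Proof. exact: measurable_funPT. Qed.

Lemma L2_linE (a : R) f g x : (a *: f + g) x = a * f x + g x.
Proof. by []. Qed.

Lemma integrable_mulL2 f g : mu.-integrable setT (EFin \o (fun x => f x * g x)).
Proof.
by apply/Lfun1_integrable; exact: (Lfun2_mul_Lfun1 (LfunP f) (LfunP g)).
Qed.

Lemma innerC f g : inner f g = inner g f.
Proof. by apply: eq_Rintegral => x _; rewrite mulrC. Qed.

Lemma inner_linl (a : R) f g h :
  inner (a *: f + g) h = a * inner f h + inner g h.
Proof.
rewrite /inner -RintegralZl//; last exact: integrable_mulL2.
rewrite -RintegralD//.
- by apply: eq_Rintegral => x _; rewrite L2_linE mulrDl mulrA.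
- have := integrableZl measurableT a (integrable_mulL2 f h).
  by apply: eq_integrable => //= x _; rewrite EFinM.
- exact: integrable_mulL2.
Qed.

Lemma inner0l g : inner 0 g = 0.
Proof. by have := inner_linl (-1) 0 0 g; rewrite scaler0 addr0 => ->; ring. Qed.

Lemma innerZl a f g : inner (a *: f) g = a * inner f g.
Proof. by have := inner_linl a f 0 g; rewrite addr0 inner0l addr0. Qed.

Lemma innerDl f g h : inner (f + g) h = inner f h + inner g h.
Proof. by have := inner_linl 1 f g h; rewrite scale1r mul1r. Qed.

Lemma innerNl f g : inner (- f) g = - inner f g.
Proof. by rewrite -scaleN1r innerZl mulN1r. Qed.

Lemma innerBl f g h : inner (f - g) h = inner f h - inner g h.
Proof. by rewrite innerDl innerNl. Qed.

Lemma innerZr a f g : inner f (a *: g) = a * inner f g.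
Proof. by rewrite innerC innerZl innerC. Qed.

Lemma innerDr f g h : inner f (g + h) = inner f g + inner f h.
Proof. by rewrite innerC innerDl (innerC g) (innerC h). Qed.

Lemma innerNr f g : inner f (- g) = - inner f g.
Proof. by rewrite innerC innerNl innerC. Qed.

Lemma innerBr f g h : inner f (g - h) = inner f g - inner f h.
Proof. by rewrite innerDr innerNr. Qed.

Lemma normL2_sqr f : normL2 f ^+ 2 = inner f f.
Proof.
apply: EFin_inj; rewrite -powR_mulrn ?fine_ge0 ?Lnorm_ge0//.
rewrite -poweR_EFin finite_norm_fine poweR_Lnorm// fineK; last first.
  exact: integrable_fin_num (integrable_mulL2 f f).
apply: eq_integral => x _ /=.
by rewrite powR_mulrn// real_normK ?num_real// expr2.
Qed.

Lemma normL2_ge0 f : 0 <= normL2 f.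
Proof. by apply: fine_ge0; exact: Lnorm_ge0. Qed.

Lemma normL2E f : normL2 f = Num.sqrt (inner f f).
Proof. by rewrite -normL2_sqr sqrtr_sqr ger0_norm// normL2_ge0. Qed.

Lemma normL2D f g : normL2 (f + g) <= normL2 f + normL2 g.
Proof. exact: ler_LnormD. Qed.

Lemma normL2Z a f : normL2 (a *: f) = `|a| * normL2 f.
Proof.
by rewrite !normL2E innerZl innerZr mulrA -expr2 sqrtrM ?sqr_ge0// sqrtr_sqr.
Qed.

Lemma normL2N f : normL2 (- f) = normL2 f.
Proof. by rewrite -scaleN1r normL2Z normrN1 mul1r. Qed.

Lemma normL2_0 : normL2 (0 : L2 mu) = 0.
Proof. by rewrite normL2E inner0l sqrtr0. Qed.

Lemma normL2_distC f g : normL2 (f - g) = normL2 (g - f).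
Proof. by rewrite -normL2N opprB. Qed.

Lemma normL2_triangle g f h : normL2 (f - h) <= normL2 (f - g) + normL2 (g - h).
Proof. by rewrite (le_trans _ (normL2D _ _))// addrA subrK. Qed.

Lemma inner_ge0 f : 0 <= inner f f.
Proof. by rewrite -normL2_sqr sqr_ge0. Qed.

Lemma Cauchy_Schwarz_L2 f g : `|inner f g| <= normL2 f * normL2 g.
Proof.
have [g0|g0] := eqVneq (inner g g) 0.
  suff -> : inner f g = 0 by rewrite normr0 mulr_ge0// normL2_ge0.
  apply/eqP/negPn/negP => fg0.
  (* With [(g, g) = 0] this scalar makes the squared norm equal to -1. *)
  have := inner_ge0 (f - ((inner f f + 1) / (2 * inner f g)) *: g).
  rewrite innerBl !innerBr !innerZl !innerZr g0 (innerC g f).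
  rewrite !mulr0 subr0.
  set a := inner f g in fg0 *.
  have -> : (inner f f + 1) / (2 * a) * a = (inner f f + 1) / 2 by field.
  lra.
have gg : 0 < inner g g by rewrite lt_neqAle eq_sym g0 inner_ge0.
rewrite -ler_sqr ?nnegrE ?mulr_ge0 ?normL2_ge0// exprMn !normL2_sqr.
rewrite real_normK ?num_real//.
have := inner_ge0 (inner g g *: f - inner f g *: g).
rewrite innerBl !innerBr !innerZl !innerZr (innerC g f).
have -> : inner g g * (inner g g * inner f f) -
          inner g g * (inner f g * inner f g) -
          (inner f g * (inner g g * inner f g) -
            inner f g * (inner f g * inner g g)) =
         inner g g * (inner f f * inner g g - inner f g ^+ 2) by ring.
by rewrite pmulr_rge0// subr_ge0.
Qed.

Lemma inner_le_normL2 f g : inner f g <= normL2 f * normL2 g.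
Proof. exact: le_trans (ler_norm _) (Cauchy_Schwarz_L2 f g). Qed.

Lemma eqL2_refl f : eqL2 f f.
Proof. exact: ae_eq_refl. Qed.

Lemma eqL2_sym f g : eqL2 f g -> eqL2 g f.
Proof. exact: ae_eq_sym. Qed.

Lemma eqL2_trans f g h : eqL2 f g -> eqL2 g h -> eqL2 f h.
Proof. exact: ae_eq_trans. Qed.

Lemma eqL2_normL2 f g : eqL2 f g <-> normL2 (f - g) = 0.
Proof.
split=> [fg|/fine_Lnormr_eq0].
  rewrite normL2E (_ : inner _ _ = 0) ?sqrtr0//.
  rewrite /inner /Rintegral (ae_eq_integral (cst 0%E))//.
  - by rewrite integral0.
  - have := integrable_mulL2 (f - g) (f - g).
    exact: measurable_int.
  - apply: filterS fg => x /(_ I) fg _.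
    change (((f x - g x) * (f x - g x))%:E = 0%E).
    by rewrite fg subrr mul0r.
apply: filterS => x /(_ I) fg _; apply/eqP; rewrite -subr_eq0; apply/eqP.
exact: fg.
Qed.

Lemma eqL2_lin a f f' g g' : eqL2 f f' -> eqL2 g g' ->
  eqL2 (a *: f + g) (a *: f' + g').
Proof.
move=> ff gg; apply: filterS2 ff gg => x /(_ I) ff /(_ I) gg _.
by rewrite !L2_linE ff gg.
Qed.

Lemma eqL2Z a f f' : eqL2 f f' -> eqL2 (a *: f) (a *: f').
Proof.
by move=> ff; have := eqL2_lin a ff (eqL2_refl 0); rewrite !addr0.
Qed.

Lemma eqL2D f f' g g' : eqL2 f f' -> eqL2 g g' -> eqL2 (f + g) (f' + g').
Proof. by move=> ff gg; have := eqL2_lin 1 ff gg; rewrite !scale1r. Qed.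

Lemma eqL2B f f' g g' : eqL2 f f' -> eqL2 g g' -> eqL2 (f - g) (f' - g').
Proof.
move=> ff gg; have := eqL2_lin (-1) gg ff.
by rewrite !scaleN1r ![- _ + _]addrC.
Qed.

Lemma eq_normL2 f g : eqL2 f g -> normL2 f = normL2 g.
Proof.
move=> /[dup] /eqL2_normL2 fg /eqL2_sym /eqL2_normL2 gf.
apply/eqP; rewrite eq_le; apply/andP; split.
  by have := normL2D (f - g) g; rewrite subrK fg add0r.
by have := normL2D (g - f) f; rewrite subrK gf add0r.
Qed.

Lemma eq_innerl f f' g : eqL2 f f' -> inner f g = inner f' g.
Proof.
move=> /eqL2_normL2 ff; apply/eqP; rewrite -subr_eq0 -innerBl -normr_le0.
by rewrite (le_trans (Cauchy_Schwarz_L2 _ _))// ff mul0r.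
Qed.

Lemma eq_innerr f g g' : eqL2 g g' -> inner f g = inner f g'.
Proof. by move=> gg; rewrite innerC (eq_innerl _ gg) innerC. Qed.

Definition cvgL2 (u : nat -> L2 mu) f := (fun n => normL2 (u n - f)) @ \oo --> (0 : R).

Lemma cvgL2_cst f : cvgL2 (fun=> f) f.
Proof. by rewrite /cvgL2 subrr normL2_0; exact: cvg_cst. Qed.

Lemma cvgL2_eq u f g : cvgL2 u f -> eqL2 f g -> cvgL2 u g.
Proof.
move=> uf fg; rewrite /cvgL2 (_ : (fun n => _) = (fun n => normL2 (u n - f)))//.
by apply/funext => n; apply: eq_normL2; apply: eqL2B (eqL2_sym fg); exact: eqL2_refl.
Qed.

Lemma cvgL2_lin a u v f g : cvgL2 u f -> cvgL2 v g ->
  cvgL2 (fun n => a *: u n + v n) (a *: f + g).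
Proof.
move=> uf vg; apply: (@squeeze_cvgr _ _ _ _ (cst 0)
  (fun n => `|a| * normL2 (u n - f) + normL2 (v n - g))).
- apply: nearW => n /=; rewrite normL2_ge0/= -normL2Z.
  by rewrite opprD addrACA -scalerBr normL2D.
- exact: cvg_cst.
- rewrite -[X in _ --> X]addr0 -[X in _ --> X + _](mulr0 `|a|).
  by apply: cvgD => //; apply: cvgMr.
Qed.

Lemma cvgL2_normL2 u f : cvgL2 u f -> (fun n => normL2 (u n)) @ \oo --> normL2 f.
Proof.
move=> uf; apply/cvgrPdist_le => e e0.
move/cvgrPdist_le/(_ e e0): uf; apply: filterS => n.
rewrite sub0r normrN ger0_norm ?normL2_ge0// => ne.
rewrite ler_norml; apply/andP; split.
  have := normL2D (u n - f) f; rewrite subrK; lra.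
have := normL2D (f - u n) (u n); rewrite subrK normL2_distC; lra.
Qed.

Lemma cvgL2_inner u v f g : cvgL2 u f -> cvgL2 v g ->
  (fun n => inner (u n) (v n)) @ \oo --> inner f g.
Proof.
move=> uf vg.
rewrite (_ : (fun n => _) =
  (fun n => inner (u n - f) (v n) + inner f (v n - g) + inner f g)); last first.
  by apply/funext => n; rewrite innerBl innerBr; ring.
rewrite -[X in _ --> X]add0r.
apply: cvgD; last exact: cvg_cst.
rewrite -[X in _ --> X]addr0.
apply: cvgD; apply/norm_cvg0P; apply: (@squeeze_cvgr _ _ _ _ (cst 0)).
- apply: nearW => n /=; rewrite normr_ge0/=; exact: Cauchy_Schwarz_L2.
- exact: cvg_cst.
- rewrite -(mul0r (normL2 g)); apply: cvgM => //; exact: cvgL2_normL2.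
- apply: nearW => n /=; rewrite normr_ge0/=; exact: Cauchy_Schwarz_L2.
- exact: cvg_cst.
- rewrite -(mulr0 (normL2 f)); apply: cvgMr => //.
Qed.

Lemma cvgL2_unique u f g : cvgL2 u f -> cvgL2 u g -> eqL2 f g.
Proof.
move=> uf ug; apply/eqL2_normL2.
have h := cvgL2_lin (-1) uf ug; have h2 := cvgL2_normL2 h.
have h0 : (fun n => normL2 (-1 *: u n + u n)) @ \oo --> (0 : R).
  rewrite (_ : (fun n => _) = cst 0); first exact: cvg_cst.
  by apply/funext => n; rewrite scaleN1r addNr normL2_0.
by rewrite -(cvg_unique (@Rhausdorff R) h2 h0) scaleN1r (addrC (- f)) normL2_distC.
Qed.

Lemma oneL2E x : oneL2 mu x = 1.
Proof.
rewrite /oneL2 /toL2 /insubd insubT//=.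
exact: (Lfun_cst mu 1 2).
Qed.

Lemma toL2E (f : T -> R) : f \in Lfun mu 2%:E -> toL2 mu f = f :> (T -> R).
Proof. by move=> fL; rewrite /toL2 /insubd insubT. Qed.

End L2_theory.

(** * Completeness of L2 and orthogonal decomposition *)

Section square_integrable.
Context {d : measure_display} {T : measurableType d} {R : realType}.
Variable mu : probability T R.

Lemma Lfun2_sqr_lty (g : T -> R) : measurable_fun setT g ->
  (\int[mu]_x (g x ^+ 2)%:E < +oo)%E -> g \in Lfun mu 2%:E.
Proof.
move=> mg goo; rewrite inE; apply/andP; split; rewrite inE//=.
rewrite /finite_norm unlock; apply: poweR_lty; apply: le_lt_trans goo.
rewrite le_eqVlt; apply/orP; left; apply/eqP.
by apply: eq_integral => x _ /=; rewrite powR_mulrn// real_normK ?num_real.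
Qed.

Lemma integral_sqr_L2 (f : L2 mu) :
  (\int[mu]_x (f x ^+ 2)%:E = (normL2 f ^+ 2)%:E)%E.
Proof.
rewrite normL2_sqr fineK; last exact: integrable_fin_num (integrable_mulL2 f f).
by apply: eq_integral => x _; rewrite expr2.
Qed.

Lemma integrable_L2 (f : L2 mu) : mu.-integrable setT (EFin \o f).
Proof.
apply/Lfun1_integrable; apply: Lfun_subset12; last exact: LfunP.
exact: fin_num_measure.
Qed.

Lemma integrable_sqr_L2 (f : L2 mu) :
  mu.-integrable setT (EFin \o (fun x => f x ^+ 2)).
Proof. exact: Lfun2_integrable_sqr (LfunP f). Qed.

Lemma Rintegral_L2 (f : L2 mu) : \int[mu]_x f x = inner f (oneL2 mu).
Proof. by apply: eq_Rintegral => x _; rewrite oneL2E mulr1. Qed.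

End square_integrable.

Lemma limn_einf_le {R : realType} (u : (\bar R)^nat) (c : \bar R) :
  (forall n, u n <= c)%E -> (limn_einf u <= c)%E.
Proof.
move=> uc; rewrite limn_einf_lim; apply: lime_le; first exact: is_cvg_einfs.
apply: nearW => n; apply: le_trans (uc n).
by apply: ereal_inf_lbound; exists n => /=.
Qed.

Section L2_complete.
Context {d : measure_display} {T : measurableType d} {R : realType}.
Variable mu : probability T R.
Implicit Types (f g h : L2 mu).

Lemma integral_abs_le_normL2 f : (\int[mu]_x `|f x|%:E <= (normL2 f)%:E)%E.
Proof.
rewrite finite_norm_fine.
have := @hoelder _ _ _ mu f (cst 1) 2 2 (measurable_L2 f) (@measurable_cst _ _ _ _ setT _).
rewrite !ltr0n [2^-1 + 2^-1](_ : _ = 1); last by rewrite [RHS]splitr !div1r.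
have -> : ('N[mu]_2%:E[EFin \o cst 1%R] = 1)%E.
  rewrite (Lnorm_cst1 mu 2) -[RHS](@poweR1r _ 2^-1).
  by congr poweR; exact: probability_setT.
move=> /(_ isT isT erefl); rewrite Lnorm1 mule1.
apply: le_trans; rewrite le_eqVlt; apply/orP; left; apply/eqP.
by apply: eq_integral => x _ /=; rewrite mulr1.
Qed.

(** Since [mu] has mass one, the increments have [L1] norm at most [2^-n], so the series of their
    absolute values has a finite integral and is finite almost everywhere. There [v n x] is [v 0 x]
    plus a partial sum of an absolutely convergent series. *)
Lemma summable_ae_cvg (v : nat -> L2 mu) :
  (forall n, normL2 (v n.+1 - v n) <= 2^-1 ^+ n) ->
  {ae mu, forall x, cvgn (fun n => v n x)}.
Proof.
move=> vle.
pose G x := (\sum_(0 <= n <oo) `|v n.+1 x - v n x|%:E)%E.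
have mv n : measurable_fun setT (fun x => `|v n.+1 x - v n x|%:E : \bar R).
  apply/measurable_EFinP; apply: measurableT_comp => //.
  by apply: measurable_funB; exact: measurable_L2.
have mG : measurable_fun setT G.
  by apply: ge0_emeasurable_sum => // k x _ _; rewrite lee_fin.
have Goo : (\int[mu]_x G x < +oo)%E.
  rewrite integral_nneseries//.
  apply: (@le_lt_trans _ _ (\sum_(0 <= n <oo) (2^-1 ^+ n)%:E)%E).
    apply: lee_nneseries => n _.
      by move=> _; apply: integral_ge0 => x _; rewrite lee_fin.
    by apply: le_trans (integral_abs_le_normL2 (v n.+1 - v n)) _; rewrite lee_fin.
  have := @cvg_geometric_series R 1 2^-1; rewrite ger0_norm// => /(_ _) cvg2.
  have /cvg_lim : (\sum_(0 <= k < n) (2^-1 ^+ k)%:E)%E @[n --> \oo] -->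
      ((1 / (1 - 2^-1))%:E : \bar R).
    rewrite (_ : (fun n => _) = EFin \o series (geometric 1 2^-1)).
      by apply: cvg_EFin; [exact: nearW|apply: cvg2; lra].
    apply/funext => n /=; rewrite sumEFin; congr EFin.
    by apply: eq_bigr => k _; rewrite /geometric/= mul1r.
  by move=> ->//; exact: ltry.
have iG : mu.-integrable setT G.
  apply/integrableP; split => //.
  under eq_integral => x _.
    rewrite gee0_abs; last by apply: nneseries_ge0 => n _ _; rewrite lee_fin.
    over.
  exact: Goo.
have := integrable_ae measurableT iG.
apply: filterS => x /(_ I) Gx.
have cabs : cvgn (series (fun n => `|v n.+1 x - v n x|)).
  apply: nondecreasing_is_cvgn.
    by apply: nondecreasing_series => n _ _.
  exists (fine (G x)) => _ [n _ <-].
  rewrite -lee_fin fineK// /series/= -sumEFin.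
  by apply: nneseries_lim_ge => k _ _; rewrite lee_fin.
have cser : cvgn (series (fun n => v n.+1 x - v n x)) by exact: (@normed_cvg R R^o).
have -> : (fun n => v n x) = (fun n => v 0%N x + series (fun n => v n.+1 x - v n x) n).
  by apply/funext => n; rewrite /series/= telescope_sumr// addrC subrK.
by apply: is_cvgD => //; exact: is_cvg_cst.
Qed.

(* Riesz-Fischer; rapidly Cauchy sequences suffice, since the minimizing
   sequence in [ex_orth_decomp] can be chosen such. *)
Lemma L2_complete (v : nat -> L2 mu) :
  (forall n, normL2 (v n.+1 - v n) <= 2^-1 ^+ n) -> exists f, cvgL2 v f.
Proof.
move=> vle.
have vtail n k : normL2 (v (n + k)%N - v n) <= 2 * 2^-1 ^+ n.
  suff : normL2 (v (n + k)%N - v n) <= 2 * 2^-1 ^+ n - 2 * 2^-1 ^+ (n + k).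
    by move/le_trans; apply; rewrite gerBl mulr_ge0// exprn_ge0.
  elim: k => [|k ih]; first by rewrite addn0 subrr normL2_0 subrr.
  apply: le_trans (normL2_triangle (v (n + k)%N) _ _) _.
  rewrite addnS; have := vle (n + k)%N; rewrite exprS.
  lra.
(* The upper limit is a measurable candidate defined everywhere; [fine] sends infinite values to 0,
   which matters only on a null set. *)
pose F x := fine (limn_esup (fun n => (v n x)%:E)).
have mF : measurable_fun setT F.
  apply: (measurableT_comp (@fine_measurable R setT measurableT)).
  apply: measurable_fun_limn_esup => n; apply/measurable_EFinP; exact: measurable_L2.
have vF : {ae mu, forall x, (fun n => v n x) @ \oo --> F x}.
  have := summable_ae_cvg vle; apply: filterS => x /cvg_ex[l vl].
  rewrite /F (_ : limn_esup _ = l%:E)//=.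
  by apply: (cvg_limn_einf_sup _).2; apply: cvg_EFin => //; exact: nearW.
(* Fatou in the index [k] with [n] fixed, applied to the squared differences of [v (n + k)] and
   [v n]. *)
have intF n : (\int[mu]_x ((F x - v n x) ^+ 2)%:E <= ((2 * 2^-1 ^+ n) ^+ 2)%:E)%E.
  have mvk k : measurable_fun setT (fun x => ((v (n + k)%N x - v n x) ^+ 2)%:E).
    apply/measurable_EFinP; apply: measurable_funX.
    by apply: measurable_funB; exact: measurable_L2.
  have := @fatou _ _ _ mu setT measurableT _ mvk.
  move=> /(_ (fun k x _ => ltac:(by rewrite lee_fin sqr_ge0))) fat.
  apply: (@le_trans _ _ (\int[mu]_x limn_einf (fun k => ((v (n + k)%N x - v n x) ^+ 2)%:E))%E).
    apply: ae_ge0_le_integral => //.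
    - by move=> x _; rewrite lee_fin sqr_ge0.
    - apply/measurable_EFinP; apply: measurable_funX.
      by apply: measurable_funB => //; exact: measurable_L2.
    - move=> x _; rewrite limn_einf_lim; apply: lime_ge; first exact: is_cvg_einfs.
      by apply: nearW => k; apply: le_ereal_inf_tmp => _ [j _ <-]; rewrite lee_fin sqr_ge0.
    - rewrite (_ : (fun x => _) = (fun x =>
        - limn_esup (fun k => - ((v (n + k)%N x - v n x) ^+ 2)%:E))%E).
        apply: measurableT_comp => //.
        by apply: measurable_fun_limn_esup => k; exact: measurableT_comp.
      apply/funext => x; rewrite -limn_einfN; congr limn_einf.
      by apply/funext => k; rewrite [RHS]oppeK.
    - apply: filterS vF => x vFx _.
      rewrite (_ : limn_einf _ = ((F x - v n x) ^+ 2)%:E)//.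
      apply: (cvg_limn_einf_sup _).1; apply: cvg_EFin; first exact: nearW.
      apply: (@cvg_comp _ _ _ _ (fun y : R => y ^+ 2) _ (nbhs (F x - v n x))); last first.
        exact: exprn_continuous.
      apply: cvgB; last exact: cvg_cst.
      have := vFx; rewrite -(cvg_shiftn n).
      by under eq_fun do rewrite addnC.
  apply: le_trans fat _; apply: limn_einf_le => k.
  rewrite (_ : (\int[mu]_x _)%E = (normL2 (v (n + k)%N - v n) ^+ 2)%:E).
    by rewrite lee_fin ler_sqr ?nnegrE ?normL2_ge0 ?mulr_ge0 ?exprn_ge0.
  exact: (integral_sqr_L2 (v (n + k)%N - v n)).
(* So far [F] is only measurable, while [F - v 0] is square-integrable by the case [n = 0]; the
   limit is therefore written as this difference plus [v 0]. *)
have F0L : (F \- v 0%N) \in Lfun mu 2%:E.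
  apply: Lfun2_sqr_lty; last exact: le_lt_trans (intF 0%N) (ltry _).
  by apply: measurable_funB => //; exact: measurable_L2.
exists (toL2 mu (F \- v 0%N) + v 0%N).
have fE n x : (v n - (toL2 mu (F \- v 0%N) + v 0%N)) x = v n x - F x.
  change (v n x - (toL2 mu (F \- v 0%N) x + v 0%N x) = v n x - F x).
  by rewrite toL2E//= subrK.
apply: (@squeeze_cvgr _ _ _ _ (cst 0) (fun n => 2 * 2^-1 ^+ n)).
- apply: nearW => n; rewrite normL2_ge0/=.
  rewrite -ler_sqr ?nnegrE ?normL2_ge0 ?mulr_ge0 ?exprn_ge0//.
  rewrite -lee_fin -integral_sqr_L2.
  apply: le_trans (intF n); rewrite le_eqVlt; apply/orP; left; apply/eqP.
  by apply: eq_integral => x _; rewrite fE -sqrrN opprB.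
- exact: cvg_cst.
- rewrite -[X in _ --> X](mulr0 2); apply: cvgMr.
  by apply: cvg_expr; rewrite ger0_norm//; lra.
Qed.

Definition linear_set (V : set (L2 mu)) :=
  V 0 /\ forall (a : R) f g, V f -> V g -> V (a *: f + g).

(** The distance from [g] is minimized over [V], which may fail to be closed, so the minimizer [f]
    is a limit of elements of [V]. Orthogonality comes from comparing [f] with [f + s w] for every
    [s]. *)
Lemma ex_orth_decomp (V : set (L2 mu)) g : linear_set V ->
  exists f (v : nat -> L2 mu),
    [/\ forall n, V (v n), cvgL2 v f & forall w, V w -> inner (g - f) w = 0].
Proof.
move=> [V0 Vlin].
pose Q := [set normL2 (g - w) ^+ 2 | w in V].
have Qlb : has_lbound Q by exists 0 => _ [w _ <-]; exact: sqr_ge0.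
have Q0 : Q !=set0 by exists (normL2 (g - 0) ^+ 2); exists 0.
have Qinf : has_inf Q by split.
pose m := inf Q.
have mle w : V w -> m <= normL2 (g - w) ^+ 2.
  by move=> Vw; apply: ge_inf => //; exists w.
(* With [e = 2^-n], the parallelogram law bounds the squared increment by
   [2 (e^2/4 + e^2/16) = 5 e^2/8], which is below the [e^2] that completeness demands. *)
have ex_v n : exists2 w, V w & normL2 (g - w) ^+ 2 < m + (2^-1 ^+ n) ^+ 2 / 4.
  have [|_ [w Vw <-] lt_w] := @inf_adherent _ Q ((2^-1 ^+ n) ^+ 2 / 4) _ Qinf.
    by rewrite divr_gt0// exprn_gt0// exprn_gt0.
  by exists w.
pose v n := sval (cid2 (ex_v n)).
have vV n : V (v n) by rewrite /v; case: cid2.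
have vm n : normL2 (g - v n) ^+ 2 < m + (2^-1 ^+ n) ^+ 2 / 4.
  by rewrite /v; case: cid2.
have [|f vf] := @L2_complete v.
  move=> n; rewrite -ler_sqr ?nnegrE ?normL2_ge0 ?exprn_ge0//.
  have Vmid : V (2^-1 *: v n.+1 + (2^-1 *: v n + 0)) by do 2 apply: (Vlin) => //.
  move: (mle _ Vmid) (vm n) (vm n.+1); rewrite addr0 (exprS 2^-1).
  rewrite !normL2_sqr !innerBl !innerBr !innerDl !innerDr !innerZl !innerZr.
  rewrite (innerC (v n) g) (innerC (v n.+1) g) (innerC (v n.+1) (v n)).
  set e := 2^-1 ^+ n; rewrite exprMn.
  have := sqr_ge0 e.
  lra.
exists f, v; split => // w Vw.
have key s : 0 <= s ^+ 2 * inner w w - 2 * s * inner (g - f) w.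
  have lim1 : (fun n => normL2 (g - v n) ^+ 2) @ \oo --> m.
    apply: (@squeeze_cvgr _ _ _ _ (cst m) (fun n => m + (2^-1 ^+ n) ^+ 2 / 4)).
    - by apply: nearW => n; rewrite mle//= ltW.
    - exact: cvg_cst.
    - rewrite -[X in _ --> X]addr0; apply: cvgD; first exact: cvg_cst.
      rewrite -[X in _ --> X](mul0r 4^-1); apply: cvgMl.
      under eq_fun do rewrite -exprM mulnC exprM.
      by apply: cvg_expr; rewrite ger0_norm//; lra.
  have gv : cvgL2 (fun n => g - v n) (g - f).
    have := cvgL2_lin (-1) vf (cvgL2_cst g).
    by under eq_fun do rewrite scaleN1r addrC; rewrite scaleN1r addrC.
  have lim2 : (fun n => inner (g - v n) (g - v n)) @ \oo --> inner (g - f) (g - f).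
    exact: cvgL2_inner.
  have mE : m = inner (g - f) (g - f).
    apply: cvg_unique lim2; first exact: Rhausdorff.
    by rewrite /=; under eq_fun do rewrite -normL2_sqr.
  have gvs : cvgL2 (fun n => (- s) *: w + (g - v n)) ((- s) *: w + (g - f)).
    exact: cvgL2_lin (cvgL2_cst w) gv.

  have : m <= inner (- s *: w + (g - f)) (- s *: w + (g - f)).
    rewrite -(cvg_lim _ (cvgL2_inner gvs gvs))//; apply: limr_ge.
      by apply/cvg_ex; eexists; exact: (cvgL2_inner gvs gvs).
    apply: nearW => n; rewrite -normL2_sqr.
    have := mle (s *: w + v n) (Vlin _ _ _ Vw (vV n)).
    by rewrite opprD addrA -scaleNr (addrC g) -addrA.
  rewrite mE; move: (g - f) => z.
  rewrite innerDl !innerDr !innerZl !innerZr (innerC w z); lra.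
set a := inner (g - f) w in key *; set b := inner w w in key *.
have b0 : 0 <= b by exact: inner_ge0.
(* The denominator [b + 1] instead of [b] also covers [w] of norm zero, and the value is still
   negative unless [a = 0]. *)
have := key (a / (b + 1)).
have -> : (a / (b + 1)) ^+ 2 * b - 2 * (a / (b + 1)) * a =
          - (a ^+ 2 * ((b + 2) / (b + 1) ^+ 2)) by field; lra.
rewrite oppr_ge0 => h; apply/eqP; rewrite -sqrf_eq0; apply/eqP/le_anti.
rewrite sqr_ge0 andbT; rewrite pmulr_lle0// in h.
by rewrite divr_gt0 ?exprn_gt0//; lra.
Qed.

(** The residual [k = g - f] is orthogonal to [V], hence to its limit [f]; if also [(k, g) = 0],
    then [(k, k) = 0]. The second premise on [k] records that [k] differs from [g] by a limit of
    [V], which [range_G_dense] uses to place [k] in [H_P]. *)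
Lemma dense_of_orth (V : set (L2 mu)) g : linear_set V ->
  (forall k, (forall w, V w -> inner k w = 0) ->
     (exists f (v : nat -> L2 mu),
        [/\ forall n, V (v n), cvgL2 v f & k = g - f]) ->
     inner k g = 0) ->
  exists2 v : nat -> L2 mu, forall n, V (v n) & cvgL2 v g.
Proof.
move=> Vlin Vorth; have [f [v [Vv vf gfV]]] := ex_orth_decomp g Vlin.
exists v => //; apply: cvgL2_eq (vf) _; apply: eqL2_sym; apply/eqL2_normL2.
have gfg : inner (g - f) g = 0 by apply: Vorth => //; exists f, v.
have gff : inner (g - f) f = 0.
  have := cvgL2_inner (cvgL2_cst (g - f)) vf.
  under eq_fun do rewrite gfV//.
  by move=> h; apply: cvg_unique h (cvg_cst _); exact: Rhausdorff.
by rewrite normL2E innerBr gfg gff subrr sqrtr0.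
Qed.

End L2_complete.

(** * Closures of operators and orthogonal projections *)

Section operators.
Context {d : measure_display} {T : measurableType d} {R : realType}.
Variable mu : probability T R.
Implicit Types (f g h : L2 mu) (U V : operator mu) (K D : set (L2 mu)).

(** Linearity is put on graphs because closures and compositions exist here only as relations. *)
Definition linear_rel U := U 0 0 /\ forall (a : R) f f' g g',
  U f f' -> U g g' -> U (a *: f + g) (a *: f' + g').

Lemma linear_rel_oper D T0 : linear_subspace D -> linear_on D T0 ->
  linear_rel (oper D T0).
Proof.
move=> [_ D0 Dlin] [_ Tlin]; split.
  split=> //; have := Tlin (-1) 0 0 D0 D0.
  rewrite scaler0 addr0 => h; apply: eqL2_sym; apply: eqL2_trans h _.
  by rewrite scaleN1r addNr; exact: eqL2_refl.
move=> a f f' g g' [Df ff] [Dg gg]; split; first exact: Dlin.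
by apply: eqL2_trans (eqL2_lin a ff gg) _; apply: eqL2_sym; exact: Tlin.
Qed.

Lemma linear_rel_comp U V : linear_rel U -> linear_rel V ->
  linear_rel (op_comp U V).
Proof.
move=> [U0 Ulin] [V0 Vlin]; split; first by exists 0.
move=> a f f' g g' [h Vfh Uhf'] [k Vgk Ukg'].
by exists (a *: h + k); [exact: Vlin|exact: Ulin].
Qed.

Lemma linear_rel_restr K U : linear_set K -> linear_rel U ->
  linear_rel (op_restr K U).
Proof.
move=> [K0 Klin] [U0 Ulin]; split; first by split.
by move=> a f f' g g' [Kf Uf] [Kg Ug]; split; [exact: Klin|exact: Ulin].
Qed.

Lemma linear_rel_closure U : linear_rel U -> linear_rel (closure_op U).
Proof.
move=> [U0 Ulin]; split.
  by exists (fun=> 0), (fun=> 0); split => //; exact: cvgL2_cst.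
move=> a f f' g g' [u [v [uvU uf vf]]] [u' [v' [uvU' ug vg]]].
exists (fun n => a *: u n + u' n), (fun n => a *: v n + v' n).
by split => [n||]; [exact: Ulin|exact: cvgL2_lin|exact: cvgL2_lin].
Qed.

Lemma closure_op_sub U f g : U f g -> closure_op U f g.
Proof.
by move=> Ufg; exists (fun=> f), (fun=> g); split => //; exact: cvgL2_cst.
Qed.

Lemma closure_op_inner U V (c : R) :
  (forall f f' g g', U f f' -> V g g' -> inner f' g = c * inner f g') ->
  forall f f' g g', closure_op U f f' -> closure_op V g g' ->
    inner f' g = c * inner f g'.
Proof.
move=> UV f f' g g' [u [v [uvU uf vf]]] [u' [v' [uvU' ug vg]]].
have h1 := cvgL2_inner vf ug.
have h2 : (fun n => c * inner (u n) (v' n)) @ \oo --> c * inner f g'.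
  by apply: cvgMr; exact: cvgL2_inner.
apply: (cvg_unique (@Rhausdorff R) h1).
by rewrite (_ : (fun n => _) = (fun n => c * inner (u n) (v' n)))//;
  apply/funext => n; exact: UV.
Qed.

(** Consequence used below: a vector orthogonal to the range of [U] satisfies the adjoint relation
    of [closure_op U] with value 0, so selfadjointness puts it in the kernel. *)
Lemma closure_orth U k : (forall f l, U f l -> inner l k = 0) ->
  forall f l, closure_op U f l -> inner l k = 0.
Proof.
move=> Uk f l [u [v [uvU uf vl]]].
have := cvgL2_inner vl (cvgL2_cst k).
rewrite (_ : (fun n => _) = cst 0).
  by move=> h; apply: cvg_unique h (cvg_cst _); exact: Rhausdorff.
by apply/funext => n; exact: Uk (uvU n).
Qed.

Lemma selfadjoint_ker_range K U f l k : selfadjoint_in K U ->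
  U f l -> U k 0 -> inner l k = 0.
Proof.
move=> [_ saU] Ufl /saU[_ _ /(_ _ _ Ufl)->].
by rewrite innerC inner0l.
Qed.

End operators.

Section projection.
Context {d : measure_display} {T : measurableType d} {R : realType}.
Variable mu : probability T R.
Implicit Types (f g h : L2 mu).
Variables (K : set (L2 mu)) (P : L2 mu -> L2 mu).
Hypotheses (Klin : linear_set K) (PK : is_orth_proj K P).

Lemma orth_proj_in f : K (P f). Proof. by have [] := PK f. Qed.

Lemma orth_proj_orth f g : K g -> inner (f - P f) g = 0.
Proof. by have [_] := PK f; apply. Qed.

(** [P] is a bare function known only through orthogonality, so its linearity, its idempotence and
    its compatibility with [eqL2] are all derived from this uniqueness. The test vector is
    [P f - k]. *)
Lemma orth_proj_uniq f k : K k -> (forall g, K g -> inner (f - k) g = 0) ->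
  eqL2 (P f) k.
Proof.
move=> Kk fk; apply/eqL2_normL2; rewrite normL2E.
have KPfk : K (P f - k).
  by have := Klin.2 (-1) _ _ Kk (orth_proj_in f); rewrite scaleN1r addrC.
have := fk _ KPfk; have := orth_proj_orth f KPfk.
rewrite !(innerBl f) => h1 h2.
by rewrite innerBl (_ : _ - _ = 0) ?sqrtr0//; lra.
Qed.

Lemma orth_proj_id f : K f -> eqL2 (P f) f.
Proof. by move=> Kf; apply: orth_proj_uniq => // g _; rewrite subrr inner0l. Qed.

Lemma orth_proj_eq f g : eqL2 f g -> eqL2 (P f) (P g).
Proof.
move=> fg; apply: orth_proj_uniq; first exact: orth_proj_in.
move=> h Kh; rewrite -(orth_proj_orth g Kh); apply: eq_innerl.
by apply: eqL2B fg _; exact: eqL2_refl.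
Qed.

Lemma orth_proj_lin (a : R) f g : eqL2 (P (a *: f + g)) (a *: P f + P g).
Proof.
apply: orth_proj_uniq; first by apply: Klin.2; exact: orth_proj_in.
move=> h Kh; have := orth_proj_orth f Kh; have := orth_proj_orth g Kh.
rewrite innerBl (innerBl f) innerBl !innerDl !innerZl => h1 h2.
have -> : inner f h = inner (P f) h by lra.
by rewrite (_ : inner g h = inner (P g) h) ?subrr//; lra.
Qed.

Lemma orth_proj_linear_on : linear_on setT P.
Proof.
by split=> [f g _|a f g _ _]; [exact: orth_proj_eq|exact: orth_proj_lin].
Qed.

Lemma orth_proj_B f g : eqL2 (P (f - g)) (P f - P g).
Proof.
by have := orth_proj_lin (-1) g f; rewrite !scaleN1r ![- _ + _]addrC.
Qed.

Lemma orth_proj_innerl f g : inner (P f) g = inner (P f) (P g).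
Proof.
have := orth_proj_orth g (orth_proj_in f); rewrite innerBl.
rewrite (innerC (P f)) (innerC (P f)) => h; lra.
Qed.

Lemma orth_proj_sym f g : inner (P f) g = inner f (P g).
Proof. by rewrite orth_proj_innerl innerC -orth_proj_innerl innerC. Qed.

Lemma orth_proj_pythagoras f :
  normL2 f ^+ 2 = normL2 (P f) ^+ 2 + normL2 (f - P f) ^+ 2.
Proof.
rewrite !normL2_sqr innerBl (innerBr f) (innerBr (P f)).
have := orth_proj_innerl f f; rewrite (innerC f (P f)) => h; lra.
Qed.

Lemma normL2_orth_proj f : normL2 (P f) <= normL2 f.
Proof.
rewrite -ler_sqr ?nnegrE ?normL2_ge0// [leRHS]orth_proj_pythagoras.
by rewrite lerDl sqr_ge0.
Qed.

Lemma normL2_orth_projC f : normL2 (f - P f) <= normL2 f.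
Proof.
rewrite -ler_sqr ?nnegrE ?normL2_ge0// [leRHS]orth_proj_pythagoras.
by rewrite lerDr sqr_ge0.
Qed.

Lemma cvgL2_orth_proj u f : cvgL2 u f -> cvgL2 (P \o u) (P f).
Proof.
move=> uf; apply: (@squeeze_cvgr _ _ _ _ (cst 0) (fun n => normL2 (u n - f))) => //.
  apply: nearW => n /=; rewrite normL2_ge0/=.
  by rewrite -(eq_normL2 (orth_proj_B _ _)) normL2_orth_proj.
exact: cvg_cst.
Qed.

Lemma linear_set_image_proj D : linear_subspace D -> linear_set (imageL2 P D).
Proof.
move=> [_ D0 Dlin]; split.
  exists 0 => //; have := orth_proj_lin (-1) 0 0.
  rewrite scaler0 addr0 => h; apply: eqL2_sym; apply: eqL2_trans h _.
  by rewrite scaleN1r addNr; exact: eqL2_refl.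
move=> a f g [f0 Df0 ff0] [g0 Dg0 gg0]; exists (a *: f0 + g0); first exact: Dlin.
by apply: eqL2_trans (eqL2_lin a ff0 gg0) _; apply: eqL2_sym; exact: orth_proj_lin.
Qed.

Lemma imageL2_proj D f : imageL2 P D f -> eqL2 (P f) f.
Proof.
move=> [g Dg fg]; apply: eqL2_trans (orth_proj_eq fg) _.
apply: eqL2_trans (orth_proj_id (orth_proj_in g)) _; exact: eqL2_sym.
Qed.

(** [P] is continuous and fixes every [v n]; this is the closedness of [H_P]. *)
Lemma imageL2_proj_closed (v : nat -> L2 mu) f :
  (forall n, imageL2 P setT (v n)) -> cvgL2 v f -> eqL2 (P f) f.
Proof.
move=> vP vf; apply: (cvgL2_unique (u := P \o v)); first exact: cvgL2_orth_proj.
rewrite /cvgL2 (_ : (fun n => _) = (fun n => normL2 (v n - f)))//.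
apply/funext => n; apply: eq_normL2; apply: eqL2B (eqL2_refl f).
exact: imageL2_proj (vP n).
Qed.

End projection.

(** * The bound for an abstract seminorm *)

Section seminorm_bound.
Context {d : measure_display} {T : measurableType d} {R : realType}.
Variable mu : probability T R.
Implicit Types (f g h : L2 mu).

(** Here [L] is a spectral gap, [x] the distance to the kernel, [q] the energy and [s] the norm of
    the image: coercivity and Cauchy-Schwarz bound each other. It serves [S] with [Lambda_m] and [G]
    with [Lambda_M]. *)
Lemma quadratic_bound (L x s q : R) : 0 < L -> 0 <= x -> 0 <= s ->
  L * x ^+ 2 <= q -> q <= s * x -> x <= s / L /\ q <= s ^+ 2 / L.
Proof.
move=> L0 x0 s0 Lxq qsx.
have xs : x <= s / L.
  rewrite ler_pdivlMr//; have [->|x_neq0] := eqVneq x 0; first by rewrite mul0r.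
  have {}x0 : 0 < x by rewrite lt_def x_neq0.
  by rewrite -(ler_pM2r x0); nra.
split => //; apply: le_trans qsx _.
by rewrite expr2 -mulrA ler_wpM2l.
Qed.

Lemma sqrt_div_sqr (x c : R) : 0 <= x -> 0 <= c ->
  Num.sqrt (x ^+ 2 / c) = x / Num.sqrt c.
Proof.
by move=> x0 c0; rewrite sqrtrM ?sqr_ge0// sqrtr_sqr ger0_norm// sqrtrV.
Qed.

(* p stands for the L2(P)-norm of the time integral over [0, t]. *)
Variables (p : L2 mu -> R) (t : R).
Hypothesis pD : forall f g, p (f + g) <= p f + p g.
Hypothesis pN : forall f, p (- f) = p f.
Hypothesis p_le : forall f, p f <= t * normL2 f.

(** By [p_le] the seminorm is continuous on [H], so a bound proved on the range of an operator
    reaches all limits of that range. *)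
Lemma seminorm_limit (u : nat -> L2 mu) (a : nat -> R) g l :
  cvgL2 u g -> (forall n, p (u n) <= a n) -> a @ \oo --> l -> p g <= l.
Proof.
move=> ug pua al.
have lim : (fun n => t * normL2 (u n - g) + a n) @ \oo --> l.
  rewrite -[X in _ --> X]add0r -[X in _ --> X + _](mulr0 t).
  by apply: cvgD => //; apply: cvgMr.
rewrite -(cvg_lim _ lim)//; apply: limr_ge; first by apply/cvg_ex; exists l.
apply: nearW => n; apply: le_trans (_ : p (g - u n) + p (u n) <= _).
  by rewrite (le_trans _ (pD _ _))// subrK.
by apply: lerD => //; rewrite normL2_distC.
Qed.

Lemma eq_seminorm f g : eqL2 f g -> p f = p g.
Proof.
have le h k : eqL2 h k -> p h <= p k.
  move=> /eqL2_normL2 hk; have := pD (h - k) k; rewrite subrK => /le_trans; apply.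
  by rewrite -[leRHS]add0r lerD2r (le_trans (p_le _))// hk mulr0.
by move=> fg; apply/le_anti; rewrite !le//; exact: eqL2_sym.
Qed.

Variables (D : set (L2 mu)) (S A : L2 mu -> L2 mu).
Hypotheses (D_subspace : linear_subspace D).
Hypotheses (S_linear : linear_on D S) (A_linear : linear_on D A).
Hypothesis A_antisymmetric :
  forall f g, D f -> D g -> inner (A f) g = - inner f (A g).

Let L f := S f - A f.
Let clL := closure_op (oper D L).
Let clS := closure_op (oper D S).
Let clA := closure_op (oper D A).

Hypothesis pS : forall f, D f ->
  p (S f) <= Num.sqrt (2 * t) * Num.sqrt (- inner (S f) f).
Hypothesis pL : forall f, D f ->
  p (L f) <= 2 * normL2 f + Num.sqrt (2 * t) * Num.sqrt (- inner (S f) f).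

Lemma closure_antisymmetric f f' g g' :
  clA f f' -> clA g g' -> inner f' g = - inner f g'.
Proof.
move=> Aff Agg; rewrite -mulN1r.
apply: (closure_op_inner _ Aff Agg) => f0 f0' g0 g0' [Df ff] [Dg gg].
by rewrite (eq_innerl _ ff) (eq_innerr _ gg) A_antisymmetric// mulN1r.
Qed.

(** On [D] antisymmetry gives [(Sf, f) = (Lf, f)]. The energy is rewritten with [L] because graph
    convergence for [L] says nothing about convergence of [S (f n)]. *)
Lemma seminorm_closureL u l : clL u l ->
  p l <= 2 * normL2 u + Num.sqrt (2 * t) * Num.sqrt (- inner l u).
Proof.
move=> [f [g [fgL fu gl]]].
apply: (seminorm_limit (u := g) (a := fun n =>
  2 * normL2 (f n) + Num.sqrt (2 * t) * Num.sqrt (- inner (g n) (f n)))) => //.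
  move=> n; have [Df gf] := fgL n.
  have -> : inner (g n) (f n) = inner (S (f n)) (f n).
    rewrite (eq_innerl _ gf) /L innerBl; have := A_antisymmetric Df Df.
    rewrite (innerC (f n) (A _)) => h; lra.
  by rewrite (eq_seminorm gf) pL.
apply: cvgD; first by apply: cvgMr; exact: cvgL2_normL2.
apply: cvgMr; apply: (@cvg_comp _ _ _ _ Num.sqrt _ (nbhs (- inner l u))).
  by apply: cvgN; exact: cvgL2_inner.
exact: sqrt_continuous.
Qed.

Variable P : L2 mu -> L2 mu.
Let N := op_ker clS.
Hypothesis P_proj : is_orth_proj N P.
Variables (Lambda_m : R).
Hypothesis E1_selfadjoint : essentially_selfadjoint_in setT (oper D S).
Hypothesis Lambda_m_gt0 : 0 < Lambda_m.
Hypothesis E1_coercive : forall f, D f ->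
  Lambda_m * normL2 (f - P f) ^+ 2 <= - inner (S f) f.

Lemma linear_ker_closureS : linear_set N.
Proof.
have [cl0 cllin] := linear_rel_closure (linear_rel_oper D_subspace S_linear).
split => // a f g Nf Ng; have := cllin a _ _ _ _ Nf Ng.
by rewrite scaler0 addr0.
Qed.

Lemma clS_range_ker f l k : clS f l -> N k -> inner l k = 0.
Proof. by move=> fl; exact: selfadjoint_ker_range E1_selfadjoint fl. Qed.

Lemma range_S_bound h : D h ->
  - inner (S h) h <= normL2 (S h) ^+ 2 / Lambda_m.
Proof.
move=> Dh; apply: (proj2 (quadratic_bound (x := normL2 (h - P h)) _ _ _ _ _)) => //.
- exact: normL2_ge0.
- exact: normL2_ge0.
- exact: E1_coercive.
(* The range of [S] is orthogonal to the kernel, so [h] may be replaced by [h - P h], the vector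
   that coercivity controls. *)
- have ShP : inner (S h) (P h) = 0.
    apply: (@clS_range_ker h); last exact: (orth_proj_in P_proj).
    by apply: closure_op_sub; split => //; exact: eqL2_refl.
  have -> : - inner (S h) h = - inner (S h) (h - P h) by rewrite innerBr ShP subr0.
  by rewrite -innerNl -(normL2N (S h)) inner_le_normL2.
Qed.

Lemma seminorm_ker_orth g :
  p (g - P g) <= Num.sqrt (2 * t) / Num.sqrt Lambda_m * normL2 (g - P g).
Proof.
have [_ Dlin] := linear_ker_closureS.
pose V := [set k | exists h, oper D S h k].
have Vlin : linear_set V.
  have [S0 Slin] := linear_rel_oper D_subspace S_linear.
  split; first by exists 0.
  by move=> a f k [h Sf] [h' Sk]; exists (a *: h + h'); exact: Slin.
have [k Vk _|v Vv vg] := dense_of_orth (g := g - P g) Vlin.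
  rewrite innerC; apply: (orth_proj_orth P_proj).
  (* A vector orthogonal to the range of [S] is in the kernel of the adjoint of the closure, which
     is [N] by selfadjointness. *)
  have [_ saS] := E1_selfadjoint; apply/saS; split => // f l fl.
  rewrite (innerC f) inner0l; apply: closure_orth fl => f' l' fl'.
  by rewrite innerC; apply: Vk; exists f'.
apply: (seminorm_limit (u := v) (a := fun n =>
   Num.sqrt (2 * t) / Num.sqrt Lambda_m * normL2 (v n))) => //; last first.
  by apply: cvgMr; exact: cvgL2_normL2.
move=> n; have [h [Dh vh]] := Vv n.
rewrite (eq_seminorm vh) (eq_normL2 vh) -mulrA.
apply: le_trans (pS Dh) _; rewrite ler_wpM2l ?sqrtr_ge0//.
rewrite mulrC -(sqrt_div_sqr (normL2_ge0 _) (ltW Lambda_m_gt0)).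
by apply: ler_wsqrtr; exact: range_S_bound.
Qed.

Let DP := imageL2 P D.
Let HP := imageL2 P setT.
Let opP := oper setT P.
Let AP := op_comp clA opP.
Let G := op_restr DP (op_comp opP (op_comp clA AP)).
Let LAP := op_restr DP (op_comp clL AP).
Let APD := op_image AP DP.
Variables (Lambda_M c1 c2 c3 : R).
Hypothesis E2_domAP : APD `<=` op_dom clA `&` op_dom clS `&` op_dom clL.
Hypothesis E2_L : forall f g h k, APD f -> clL f g -> clS f h -> clA f k ->
  eqL2 g (h - k).
Hypotheses (c1_ge0 : 0 <= c1) (c2_ge0 : 0 <= c2).
Hypothesis E2_bound : forall f g h, DP f -> LAP f g -> G f h ->
  normL2 g <= c1 * normL2 h + c2 * normL2 f.
Hypothesis E3_selfadjoint : essentially_selfadjoint_in HP G.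
Hypothesis Lambda_M_gt0 : 0 < Lambda_M.
Hypothesis E3_coercive : forall f g, DP f -> G f g ->
  Lambda_M * normL2 (f - inner f (oneL2 mu) *: oneL2 mu) ^+ 2 <= - inner g f.
Hypothesis E3_one : HP (oneL2 mu) /\ closure_op G (oneL2 mu) 0.
Hypothesis c3_ge0 : 0 <= c3.
Hypothesis E4 : forall f g h k, DP f -> AP f g -> clS g h -> G f k ->
  inner h g = c3 * inner k f.

Let one : L2 mu := oneL2 mu.

Lemma linear_rel_G : linear_rel G.
Proof.
have Pset : linear_subspace (setT : set (L2 mu)) by split.
have linP := linear_rel_oper Pset (orth_proj_linear_on linear_ker_closureS P_proj).
have linA := linear_rel_closure (linear_rel_oper D_subspace A_linear).
apply: linear_rel_restr.
  exact: (linear_set_image_proj linear_ker_closureS P_proj).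
by apply: linear_rel_comp => //; apply: linear_rel_comp => //; exact: linear_rel_comp.
Qed.

Lemma G_one_orth h k : G h k -> inner k one = 0.
Proof.
move=> Ghk; apply: (selfadjoint_ker_range E3_selfadjoint _ E3_one.2).
exact: closure_op_sub Ghk.
Qed.

Lemma G_bounds h k : G h k ->
  normL2 (h - inner h one *: one) <= normL2 k / Lambda_M /\
  - inner k h <= normL2 k ^+ 2 / Lambda_M.
Proof.
move=> Ghk; apply: quadratic_bound => //.
- exact: normL2_ge0.
- exact: normL2_ge0.
- by apply: E3_coercive => //; case: Ghk.
(* Centring [h] leaves the energy unchanged, since the range of [G] is orthogonal to 1. *)
- have -> : inner k h = inner k (h - inner h one *: one).
    by rewrite innerBr innerZr (G_one_orth Ghk) mulr0 subr0.
  by rewrite -innerNl -(normL2N k) inner_le_normL2.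
Qed.

(* With u = APh, PS = 0 gives Gh = PAu = P(S - L)u = - PLu. *)
Lemma G_decomp h k : G h k -> exists u l s,
  [/\ APD u, AP h u, clL u l, clS u s &
      [/\ eqL2 k (- P l), inner u u = - inner k h & inner l u = inner s u]].
Proof.
move=> [DPh [v [u APhu Auv] [_ kPv]]].
have APDu : APD u by exists h.
have [[_ [s us]] [l ul]] := E2_domAP APDu.
exists u, l, s; split => //; have lsv := E2_L APDu ul us Auv.
have linN := linear_ker_closureS.
have [g [_ gPh] Agu] := APhu.
have Ph := imageL2_proj linN P_proj DPh.
split.
- apply: eqL2_trans kPv _; apply: eqL2_sym.
  have Ps : eqL2 (P s) 0.
    apply: (orth_proj_uniq linN P_proj); first exact: linN.1.
    by move=> g' Ng'; rewrite subr0; exact: clS_range_ker us Ng'.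
  have := eqL2_trans (orth_proj_eq linN P_proj lsv) (orth_proj_B linN P_proj s v).
  move=> /(eqL2Z (-1)); rewrite scaleN1r => /eqL2_trans; apply.
  have := eqL2Z (-1) (eqL2B Ps (eqL2_refl (P v))).
  by rewrite sub0r [in X in eqL2 _ X]scaleN1r opprK.
- rewrite (closure_antisymmetric Agu Auv) (eq_innerl _ gPh); congr (- _).
  rewrite (orth_proj_innerl P_proj) -(eq_innerr _ kPv) innerC.
  by rewrite (eq_innerr _ Ph).
(* [v = Au] is orthogonal to [u] by antisymmetry, so [L] and [S] have the same energy at [u]; this
   makes (E4) applicable. *)
- rewrite (eq_innerl _ lsv) innerBl.
  have := closure_antisymmetric Auv Auv; rewrite (innerC u) => e.
  have -> : inner v u = 0 by lra.
  by rewrite subr0.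
Qed.


(** With [l = Lu], the term [p l] has boundary part [2 |u|] and an energy that (E4) turns into
    [- c3 (k, h)], while [p (l - P l)] is handled by the bound of (E2) on [|l|]. The [|h|] inherited
    from (E2) remains because [h] is not yet centred. *)
Lemma seminorm_G h k : G h k ->
  p k <= (2 / Num.sqrt Lambda_M
          + Num.sqrt (2 * t) * (Num.sqrt c3 / Num.sqrt Lambda_M
                                + c1 / Num.sqrt Lambda_m)) * normL2 k
         + Num.sqrt (2 * t) * c2 / Num.sqrt Lambda_m * normL2 h.
Proof.
move=> Ghk; have [u [l [s [APDu APhu ul us [kPl uu lu]]]]] := G_decomp Ghk.
have [_ kh] := G_bounds Ghk; have DPh : DP h by case: Ghk.
have Lm0 : 0 < Num.sqrt Lambda_m by rewrite sqrtr_gt0.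
have LM0 : 0 < Num.sqrt Lambda_M by rewrite sqrtr_gt0.
have nk0 := normL2_ge0 k.
have lnorm : normL2 l <= c1 * normL2 k + c2 * normL2 h.
  by apply: E2_bound Ghk => //; split => //; exists u.
have unorm : normL2 u <= normL2 k / Num.sqrt Lambda_M.
  by rewrite normL2E uu -(sqrt_div_sqr nk0 (ltW Lambda_M_gt0)) ler_wsqrtr.
have lunorm : Num.sqrt (- inner l u) <= Num.sqrt c3 / Num.sqrt Lambda_M * normL2 k.
  rewrite lu (E4 DPh APhu us Ghk) -mulrN sqrtrM// -mulrA ler_wpM2l ?sqrtr_ge0//.
  by rewrite mulrC -(sqrt_div_sqr nk0 (ltW Lambda_M_gt0)) ler_wsqrtr.
have pk : p k <= p l + p (l - P l).
  have := pD (- l) (l - P l); rewrite pN addrA addNr add0r.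
  by rewrite (eq_seminorm kPl).
apply: le_trans pk _.
have pl := seminorm_closureL ul.
have plP := seminorm_ker_orth l.
have lPn : normL2 (l - P l) <= c1 * normL2 k + c2 * normL2 h.
  exact: le_trans (normL2_orth_projC P_proj l) lnorm.
have {}plP : p (l - P l) <=
    Num.sqrt (2 * t) / Num.sqrt Lambda_m * (c1 * normL2 k + c2 * normL2 h).
  by apply: le_trans plP _; rewrite ler_wpM2l// divr_ge0// sqrtr_ge0.
have {}pl : p l <= 2 * (normL2 k / Num.sqrt Lambda_M) +
    Num.sqrt (2 * t) * (Num.sqrt c3 / Num.sqrt Lambda_M * normL2 k).
  by apply: le_trans pl _; rewrite lerD// ler_wpM2l// sqrtr_ge0.
apply: le_trans (lerD pl plP) _.
by rewrite le_eqVlt; apply/orP; left; apply/eqP; ring.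
Qed.

Lemma inner_one_one : inner one one = 1.
Proof.
rewrite /inner (_ : (fun x => _) = cst 1); last first.
  by apply/funext => x; rewrite !oneL2E mulr1.
have -> : \int[mu]_x cst (1 : R) x = 1 * fine (mu setT) by exact: Rintegral_cst.
by rewrite probability_setT mulr1.
Qed.

Lemma normL2_center k :
  normL2 (k - inner k one *: one) ^+ 2 = inner k k - inner k one ^+ 2.
Proof.
rewrite normL2_sqr innerBl !innerBr !innerZl !innerZr inner_one_one (innerC one k).
ring.
Qed.

(** (E3) bounds the variance only on [D_P]. Written as [(u, u) - (u, 1)^2], the variance passes to
    the limit along the approximating sequence, where the energy tends to 0. *)
Lemma ker_closureG k : closure_op G k 0 -> eqL2 k (inner k one *: one).
Proof.
move=> [u [v [uvG uk v0]]]; apply/eqL2_normL2.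
have h1 : (fun n => Lambda_M * (inner (u n) (u n) - inner (u n) one ^+ 2)) @ \oo -->
    Lambda_M * (inner k k - inner k one ^+ 2).
  apply: cvgMr; apply: cvgB; first exact: cvgL2_inner.
  have h := cvgL2_inner uk (cvgL2_cst one).
  apply: (@cvg_comp _ _ _ _ (fun y : R => y ^+ 2) _ (nbhs (inner k one))) => //.
  exact: exprn_continuous.
have h2 : (fun n => - inner (v n) (u n)) @ \oo --> (0 : R).
  rewrite -oppr0 -(inner0l k); apply: cvgN; exact: cvgL2_inner.
have : Lambda_M * (inner k k - inner k one ^+ 2) <= 0.
  rewrite -(cvg_lim _ h1)// -(cvg_lim _ h2)//; apply: ler_lim.
  - by apply/cvg_ex; eexists; exact: h1.
  - by apply/cvg_ex; eexists; exact: h2.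
  - apply: nearW => n; rewrite -normL2_center; apply: E3_coercive => //.
    by case: (uvG n).
rewrite pmulr_rle0// -normL2_center => h; apply/eqP.
by rewrite -sqrf_eq0; apply/eqP/le_anti; rewrite h sqr_ge0.
Qed.

(** A [k] orthogonal to the range of [G] is in the kernel of its selfadjoint closure, hence a
    multiple of 1, and [P f] is orthogonal to 1 because [P 1 = 1]. *)
Lemma range_G_dense f : inner f one = 0 ->
  exists2 v : nat -> L2 mu, forall n, exists h, G h (v n) & cvgL2 v (P f).
Proof.
move=> f1; have linN := linear_ker_closureS.
have [G0 Glin] := linear_rel_G.
apply: (dense_of_orth (V := [set k | exists h, G h k])).
  split; first by exists 0.
  by move=> a k k' [h Gk] [h' Gk']; exists (a *: h + h'); exact: Glin.
move=> k Vk [g [v [Vv vg kE]]].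
have HPv n : HP (v n) by have [h [_ [w _ [_ vw]]]] := Vv n; exists w.
have Pg : eqL2 (P g) g := imageL2_proj_closed linN P_proj HPv vg.
(* Selfadjointness holds inside [H_P], so [k] must first be placed there: it is [P f - g] with [g]
   fixed by [P]. *)
have HPk : HP k.
  exists (f - g) => //; rewrite kE; apply: eqL2_sym.
  apply: eqL2_trans (orth_proj_B linN P_proj f g) _.
  by apply: eqL2B Pg; exact: eqL2_refl.
have clGk : closure_op G k 0.
  apply/(E3_selfadjoint.2); split => //.
    have [q _ Pq] : imageL2 P setT 0 by exact: (linear_set_image_proj linN P_proj _).1.
    by exists q.
  move=> h l hl; rewrite (innerC h) inner0l; apply: closure_orth hl => h' l' Gl.
  by rewrite innerC; apply: Vk; exists h'.
rewrite (eq_innerl _ (ker_closureG clGk)) innerZl -(orth_proj_sym P_proj).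
by rewrite (eq_innerl _ (imageL2_proj linN P_proj E3_one.1)) (innerC one) f1 mulr0.
Qed.

(** The term in [|h|] is removed by passing to a centred preimage, of norm at most [|k| / Lambda_M];
    this creates the summand with [c2]. *)
Lemma seminorm_centered_P f : inner f one = 0 ->
  p (P f) <= (2 / Num.sqrt Lambda_M
          + Num.sqrt (2 * t) * (Num.sqrt c3 / Num.sqrt Lambda_M
                                + c1 / Num.sqrt Lambda_m
                                + c2 / (Num.sqrt Lambda_m * Lambda_M)))
             * normL2 (P f).
Proof.
move=> f1; have [v Gv vPf] := range_G_dense f1.
have Lm0 : 0 < Num.sqrt Lambda_m by rewrite sqrtr_gt0.
set C := (X in X * _).
apply: (seminorm_limit (u := v) (a := fun n => C * normL2 (v n))) => //; last first.
  by apply: cvgMr; exact: cvgL2_normL2.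
move=> n; have [h Gh] := Gv n; have [hv _] := G_bounds Gh.
(* The centred vector h - (h, 1)1 need not lie in D_P, hence the
   approximation of 1 by w within D_P. *)
have [w [z [wzG w1 z0]]] := E3_one.2.
set a := 2 / Num.sqrt Lambda_M
          + Num.sqrt (2 * t) * (Num.sqrt c3 / Num.sqrt Lambda_M
                                + c1 / Num.sqrt Lambda_m).
set b := Num.sqrt (2 * t) * c2 / Num.sqrt Lambda_m.
have b0 : 0 <= b by rewrite divr_ge0 ?mulr_ge0 ?sqrtr_ge0.
pose c := - inner h one.
(* Adding [c w] to the preimage adds [c z] to the image. As [z] tends to 0, the images still tend to
   [v n] while the preimages tend to the centred [h]. *)
have vlim : cvgL2 (fun m => c *: z m + v n) (v n).
  by have := cvgL2_lin c z0 (cvgL2_cst (v n)); rewrite scaler0 add0r.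
have hlim : cvgL2 (fun m => c *: w m + h) (c *: one + h).
  exact: cvgL2_lin w1 (cvgL2_cst h).
have : p (v n) <= a * normL2 (v n) + b * normL2 (c *: one + h).
  apply: (seminorm_limit (u := fun m => c *: z m + v n) (a := fun m =>
    a * normL2 (c *: z m + v n) + b * normL2 (c *: w m + h))) => //.
    by move=> m; apply: seminorm_G; apply: linear_rel_G.2.
  by apply: cvgD; apply: cvgMr; exact: cvgL2_normL2.
move=> /le_trans; apply.
rewrite /c scaleNr (addrC (- _)).
apply: (@le_trans _ _ (a * normL2 (v n) + b * (normL2 (v n) / Lambda_M))).
  by rewrite lerD2l ler_wpM2l.
rewrite le_eqVlt; apply/orP; left; apply/eqP.
by rewrite /a /b /C; field; rewrite !gt_eqF ?sqrtr_gt0.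
Qed.

(** Each of [|f - P f|] and [|P f|] is at most [|f|], so the constants of the two parts add up. *)
Theorem seminorm_centered f : inner f one = 0 ->
  p f <= (2 / Num.sqrt Lambda_M
          + Num.sqrt (2 * t) * ((c1 + 1) / Num.sqrt Lambda_m
                                + c2 / (Num.sqrt Lambda_m * Lambda_M)
                                + Num.sqrt c3 / Num.sqrt Lambda_M))
             * normL2 f.
Proof.
move=> f1; have linN := linear_ker_closureS.
have := pD (f - P f) (P f); rewrite subrK => /le_trans; apply.
apply: le_trans (lerD (seminorm_ker_orth f) (seminorm_centered_P f1)) _.
have s0 := sqrtr_ge0 (2 * t).
have Lm0 : 0 < Num.sqrt Lambda_m by rewrite sqrtr_gt0.
have LM0 : 0 < Num.sqrt Lambda_M by rewrite sqrtr_gt0.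
set C := (X in _ + X * _ <= _).
have C0 : 0 <= C.
  by rewrite addr_ge0 ?divr_ge0 ?mulr_ge0 ?addr_ge0 ?divr_ge0 ?mulr_ge0 ?sqrtr_ge0// ltW.
apply: (@le_trans _ _ (Num.sqrt (2 * t) / Num.sqrt Lambda_m * normL2 f + C * normL2 f)).
  rewrite lerD ?ler_wpM2l ?divr_ge0//.
  - exact: normL2_orth_projC P_proj f.
  - exact: normL2_orth_proj P_proj f.
rewrite le_eqVlt; apply/orP; left; apply/eqP.
by rewrite /C; field; rewrite !gt_eqF ?sqrtr_gt0.
Qed.

End seminorm_bound.

(** * Joint measurability of paths *)

Section time_reflection.
Context {R : realType}.
Local Notation leb := (@lebesgue_measure R).
Variable T : R.

Let refl (s : R) : measurableTypeR R := T - s.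

Let measurable_refl : measurable_fun setT refl.
Proof. exact: measurable_funB. Qed.

Let refl_preimage : refl @^-1` `[0, T]%classic = `[0, T]%classic.
Proof.
apply/seteqP; split => s /=; rewrite !in_itv/= => /andP[h1 h2]; apply/andP;
  rewrite /refl in h1 h2 *; split; lra.
Qed.

Let lebesgue_refl (A : set R) : measurable A ->
  pushforward leb refl A = leb A.
Proof.
move=> mA; apply/esym/lebesgue_measure_unique => //= _ [[a b]] _ <-.
have -> : pushforward leb refl `]a, b]%classic = leb `[T - b, T - a[%classic.
  congr (leb _); apply/seteqP; split => s /=; rewrite !in_itv/= => /andP[h1 h2];
  apply/andP; rewrite /refl in h1 h2 *; split; lra.
rewrite !lebesgue_measure_itv/= !lte_fin ltrD2l ltrN2; case: ifP => // _.
rewrite -!EFinB; congr EFin; ring.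
Qed.

Let ge0_integral_reflection (F : R -> \bar R) : measurable_fun setT F ->
  (forall s, 0 <= F s)%E ->
  (\int[leb]_(s in `[0%R, T]) F (T - s)%R = \int[leb]_(s in `[0%R, T]) F s)%E.
Proof.
move=> mF F0; rewrite -{1}refl_preimage.
rewrite (_ : (\int[leb]_(s in _) _ = \int[leb]_(s in refl @^-1` `[0%R, T]) (F \o refl) s)%E)//.
rewrite -ge0_integral_pushforward//=.
- by apply: eq_measure_integral => A mA _; exact: lebesgue_refl.
- exact: measurable_funS mF.
Qed.

(** Positive and negative parts are reflected separately, which avoids integrability: the identity
    is applied on every path, including those on which the time integral does not converge. *)
Lemma integral_reflection (F : R -> \bar R) : measurable_fun setT F ->
  (\int[leb]_(s in `[0%R, T]) F (T - s)%R = \int[leb]_(s in `[0%R, T]) F s)%E.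
Proof.
move=> mF; rewrite integralE [RHS]integralE; congr (_ - _)%E.
- have F0 s : (0 <= F^\+ s)%E by exact: funepos_ge0.
  rewrite -(ge0_integral_reflection (measurable_funepos mF) F0).
  by apply: eq_integral => s _; rewrite !funeposE.
- have F0 s : (0 <= F^\- s)%E by exact: funeneg_ge0.
  rewrite -(ge0_integral_reflection (measurable_funeneg mF) F0).
  by apply: eq_integral => s _; rewrite !funenegE.
Qed.

End time_reflection.

Section path_measurability.
Context {R : realType} {E : pmetricType R}.
Local Notation W := (pathType (half_line R) E).
Local Notation mR := (measurableTypeR R).

Lemma measurable_path_at (t : R) : measurable_fun setT (@path_at R E t).
Proof.
move=> _ B mB; rewrite setTI; apply: sub_sigma_algebra.
by exists (to_time t), B.
Qed.

Lemma measurable_into_paths d (Y : measurableType d) (I : set R)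
    (phi : Y -> pathType I E) :
  (forall s, measurable_fun setT (fun y => (phi y : continuousType I E) s : borelType E)) ->
  measurable_fun setT phi.
Proof.
move=> mphi; apply: (@measurability _ _ Y (pathType I E) _ _ (@cylinders R I E setT) erefl).
move=> _ [_ [s [B _ [mB ->]] <-]]; have := mphi s measurableT B mB.
by rewrite !setTI.
Qed.

Lemma continuous_path_at (w : W) : continuous (fun s => path_at s w : E).
Proof.
have cto : continuous (@to_time R).
  apply: (@continuous_comp_initial (set_type (half_line R)) R R set_val (@to_time R)).
  move=> s; apply: (@continuous_max R R (cst 0) id); [exact: cst_continuous|exact: cvg_id].
move=> s; apply: (@continuous_comp _ _ _ (@to_time R)
  (w : continuousType (half_line R) E)); first exact: cto.
exact: (@cts_fun _ _ (w : continuousType (half_line R) E)).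
Qed.

(* The closure makes this set Borel without assuming that balls are open. *)
Let shrink (U : set E) (n : nat) : set E :=
  closure [set x | forall y, ball x (2 * n.+1%:R^-1) y -> U y].

(** By continuity, the position at time [s] is decided by the positions at rational times near [s],
    so countably many coordinates suffice. Negative rationals do no harm, since [path_at] then reads
    the position at time 0. *)
Let open_pathE (U : set E) : open U ->
  [set z : W * mR | U (path_at z.2 z.1)] =
  \bigcup_(n : nat) ~` \bigcup_(r : rat)
    ((fst @^-1` (@path_at R E (ratr r) @^-1` (~` shrink U n))) `&`
     (snd @^-1` [set s : R | `|ratr r - s| < n.+1%:R^-1])).
Proof.
move=> oU; apply/seteqP; split => [[w s]/= Us|[w s] [n _ /=]].
  have /nbhs_ballP[e /= e0 eU] := open_nbhs_nbhs (conj oU Us).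
  have := @continuous_path_at w s; rewrite /continuous_at.
  have e2 : 0 < e / 2 by rewrite divr_gt0.
  move=> /cvg_ball/(_ _ e2) /nbhs_ballP[dl /= dl0 dlU].
  (* Near [s] the path stays within [e / 2] of its value at [s], and [n] is chosen so that balls of
     radius [2 / (n + 1) < e / 2] around it remain in the [e]-ball. *)
  have m0 : 0 < Num.min dl (e / 4) by rewrite lt_min dl0 divr_gt0.
  have [n nm] : exists n, n.+1%:R^-1 < Num.min dl (e / 4).
    by exists (Num.truncn (Num.min dl (e / 4))^-1); rewrite invf_plt ?posrE// truncnS_gt.
  move: nm; rewrite lt_min => /andP[ndl ne4].
  exists n => // -[r _ [/= nU rs]]; apply: nU; apply: subset_closure => y.
  have /dlU : ball s dl (ratr r) by rewrite /ball/= distrC (lt_trans rs).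
  move=> sr ry; apply: eU; rewrite /= [e](splitr); apply: ball_triangle sr _.
  apply: le_ball ry; rewrite (_ : e / 2 = 2 * (e / 4)); last by field.
  by rewrite ler_wpM2l// ltW.
(* The radius [2 e] in [shrink] pays for two errors of size [e]: from the position at [s] to that at
   [r], and from there to a point supplied by the closure. *)
move=> nU; set e := n.+1%:R^-1 in nU.
have e0 : 0 < e by rewrite invr_gt0.
have /cvg_ball/(_ e e0)/nbhs_ballP[dl /= dl0 dlU] := @continuous_path_at w s.
have m0 : 0 < Num.min dl e by rewrite lt_min dl0.
have [r] := @rat_in_itvoo R s (s + Num.min dl e) ltac:(by rewrite ltrDl).
rewrite in_itv/= => /andP[sr rs].
have : `|ratr r - s| < Num.min dl e by rewrite gtr0_norm ?subr_gt0// ltrBlDl.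
rewrite lt_min => /andP[rdl re].
have Xr : shrink U n (path_at (ratr r) w : E).
  by apply/not_notP => h; apply: nU; exists r.
have /(_ _ (nbhsx_ballx _ _ e0))[x [/= xU rx]] := Xr.
apply: xU; rewrite /= (_ : 2 * e = e + e); last by ring.
apply: ball_triangle (ball_sym rx) (ball_sym _).
by apply: dlU; rewrite /ball/= distrC.
Qed.

(** Tonelli needs this to exchange expectation and time integral. *)
Lemma measurable_path_at2 :
  measurable_fun setT (fun z : W * mR => path_at z.2 z.1).
Proof.
apply: (@measurability _ _ (W * mR)%type (borelType E) _ _ (@open E) erefl).
move=> _ [U oU <-]; rewrite setTI.
have -> : (fun z : W * mR => path_at z.2 z.1) @^-1` U =
  [set z : W * mR | U (path_at z.2 z.1)] by [].
rewrite open_pathE//; apply: bigcupT_measurable => n; apply: measurableC.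
apply: bigcupT_measurable_rat => r; apply: measurableI.
- have mP : measurable (@path_at R E (ratr r) @^-1` (~` shrink U n)).
    rewrite -[X in measurable X]setTI; apply: measurable_path_at => //.
    apply: measurableC; rewrite -[X in measurable X]setCK; apply: measurableC.
    by apply: sub_sigma_algebra; apply: closed_openC; exact: closed_closure.
  by rewrite -[X in measurable X]setTI; apply: measurable_fst.
- have mP : measurable [set s : mR | `|ratr r - s| < n.+1%:R^-1].
    rewrite (_ : [set _ | _] = ball (ratr r : R) n.+1%:R^-1)//.
    exact: measurable_ball.
  by rewrite -[X in measurable X]setTI; apply: measurable_snd.
Qed.

End path_measurability.

(** * Time integrals under an invariant law *)

Section time_integrals.
Context {R : realType} {E : pmetricType R}.
Local Notation W := (pathType (half_line R) E).
Local Notation mR := (measurableTypeR R).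
Local Notation leb := (@lebesgue_measure R).
Variables (mu : probability (borelType E) R) (PP : probability W R).
Hypothesis PP_invariant : has_invariant_measure mu PP.

Lemma lebesgue_measure_0t (t : R) : 0 <= t ->
  leb (`[0, t]%classic : set mR) = t%:E.
Proof.
move=> t0; rewrite lebesgue_measure_itv/= lte_fin.
by case: ltP => [_|t0']; rewrite ?sube0//; congr EFin; apply/le_anti/andP.
Qed.

Lemma ge0_integral_path_at (s : R) (F : borelType E -> \bar R) : 0 <= s ->
  measurable_fun setT F -> (forall x, 0 <= F x)%E ->
  (\int[PP]_w F (path_at s w) = \int[mu]_x F x)%E.
Proof.
move=> s0 mF F0; rewrite -[LHS](@ge0_integral_pushforward _ _ _ _ _ _
  (measurable_path_at s) PP setT F measurableT mF (fun x _ => F0 x)).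
apply: eq_measure_integral => [|? B mB _]; first exact: measurable_path_at.
exact: (PP_invariant s0 mB).
Qed.

Lemma measurable_path_comp (F : borelType E -> \bar R) (w : W) :
  measurable_fun setT F -> measurable_fun setT (fun s : mR => F (path_at s w)).
Proof.
move=> mF; apply: (measurableT_comp mF).
exact: (measurableT_comp measurable_path_at2 (pair1_measurable w)).
Qed.

Lemma measurable_path_compR (g : borelType E -> R) (w : W) :
  measurable_fun setT g -> measurable_fun setT (fun s : mR => g (path_at s w)).
Proof.
move=> mg; apply/measurable_EFinP.
by apply: (@measurable_path_comp (EFin \o g)); exact/measurable_EFinP.
Qed.

(** The time window is an indicator, so that Tonelli applies on the whole product. *)
Let slab (F : borelType E -> \bar R) (t : R) (z : W * mR) : \bar R :=
  (F (path_at z.2 z.1) * (\1_(`[0%R, t]%classic) z.2)%:E)%E.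

Let measurable_slab F t : measurable_fun setT F -> measurable_fun setT (slab F t).
Proof.
move=> mF; apply: emeasurable_funM.
  by apply: measurableT_comp => //; exact: measurable_path_at2.
apply/measurable_EFinP; apply: measurableT_comp; last exact: measurable_snd.
exact: measurable_indic.
Qed.

Let slabE F t w : (\int[leb]_s slab F t (w, s) =
  \int[leb]_(s in `[0%R, t]) F (path_at s w))%E.
Proof.
rewrite [RHS]integral_mkcond; apply: eq_integral => s _.
rewrite /slab/= patchE indicE; case: ifPn => _; first by rewrite mule1.
by rewrite mule0.
Qed.

Lemma ge0_measurable_time_integral F t : measurable_fun setT F ->
  (forall x, 0 <= F x)%E ->
  measurable_fun setT (fun w : W => \int[leb]_(s in `[0%R, t]) F (path_at s w))%E.
Proof.
move=> mF F0; have := @measurable_fun_fubini_tonelli_F _ _ W mR R leb (slab F t)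
  (measurable_slab t mF).
move=> /(_ (fun z => ltac:(by rewrite mule_ge0// lee_fin))).
by congr measurable_fun; apply/funext => w; exact: slabE.
Qed.

Lemma ge0_expectation_time_integral F t : 0 <= t -> measurable_fun setT F ->
  (forall x, 0 <= F x)%E ->
  (\int[PP]_w \int[leb]_(s in `[0%R, t]) F (path_at s w) =
   t%:E * \int[mu]_x F x)%E.
Proof.
move=> t0 mF F0; under eq_integral do rewrite -slabE.
rewrite fubini_tonelli//=; last 2 first.
- exact: measurable_slab.
- by move=> z; rewrite mule_ge0// lee_fin.
transitivity (\int[leb]_s ((\int[mu]_x F x) * (\1_(`[0%R, t]%classic) s)%:E))%E.
  apply: eq_integral => s _; rewrite /slab/= indicE.
  have [|_] := boolP (s \in `[0, t]%classic); last first.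
    by rewrite mule0; under eq_integral do rewrite mule0; rewrite integral0.
  rewrite inE/= in_itv/= => /andP[s0 _]; rewrite mule1.
  under eq_integral do rewrite mule1.
  exact: ge0_integral_path_at.
rewrite ge0_integralZl//=; last 2 first.
- by apply/measurable_EFinP; exact: measurable_indic.
- exact: integral_ge0.
rewrite integral_indic// setIT muleC; congr (_ * _)%E.
exact: lebesgue_measure_0t.
Qed.

Lemma measurable_time_int (g : borelType E -> R) t : measurable_fun setT g ->
  measurable_fun setT (time_int g t : W -> R).
Proof.
move=> mg; have mgE : measurable_fun setT (EFin \o g) by exact/measurable_EFinP.
apply: (@measurableT_comp _ _ _ _ _ _ (@fine R)); first exact: fine_measurable.
rewrite (_ : (fun w : W => _) = (fun w : W =>
  \int[leb]_(s in `[0%R, t]) (EFin \o g)^\+ (path_at s w) -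
  \int[leb]_(s in `[0%R, t]) (EFin \o g)^\- (path_at s w))%E); last first.
  apply/funext => w; rewrite integralE.
  by congr (_ - _)%E; apply: eq_integral => s _; rewrite ?funeposE ?funenegE.
apply: emeasurable_funB; apply: ge0_measurable_time_integral => //.
- exact: measurable_funepos.
- exact: measurable_funeneg.
Qed.

(** By Tonelli and invariance, the expected time integral of [|g|] is [t] times its [mu]-integral,
    hence finite. Because of the exceptional paths, linearity of [time_int] is available only almost
    surely. *)
Lemma integrable_path_ae (g : borelType E -> R) t : 0 <= t ->
  mu.-integrable setT (EFin \o g) ->
  {ae PP, forall w, leb.-integrable `[0, t] (EFin \o (fun s => g (path_at s w)))}.
Proof.
move=> t0 /integrableP[mg goo].
pose F x := `|(EFin \o g) x|%E.
have mF : measurable_fun setT F by exact: measurableT_comp.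
have F0 x : (0 <= F x)%E by exact: abse_ge0.
have iF : PP.-integrable setT
    (fun w : W => \int[leb]_(s in `[0%R, t]) F (path_at s w))%E.
  apply/integrableP; split; first exact: ge0_measurable_time_integral.
  under eq_integral => w _ do rewrite gee0_abs ?integral_ge0//.
  rewrite ge0_expectation_time_integral// lte_mul_pinfty//.
have := integrable_ae measurableT iF; apply: filterS => w /(_ I) Fw.
apply/integrableP; split.
  apply: measurable_funTS; exact: (measurable_path_comp w mg).
by rewrite -ge0_fin_numE ?integral_ge0.
Qed.

Lemma time_int_lin_ae (a : R) (g h : borelType E -> R) t : 0 <= t ->
  mu.-integrable setT (EFin \o g) -> mu.-integrable setT (EFin \o h) ->
  {ae PP, forall w, time_int (fun x => a * g x + h x) t w =
    a * time_int g t w + time_int h t w}.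
Proof.
move=> t0 ig ih; apply: filterS2 (integrable_path_ae t0 ig) (integrable_path_ae t0 ih).
move=> w igw ihw; rewrite /time_int RintegralD//.
  by rewrite RintegralZl.
have mD : measurable (`[0, t]%classic : set mR) by exact: measurable_itv.
have := integrableZl mD a igw.
by apply: eq_integrable => //= s _; rewrite EFinM.
Qed.

Lemma ge0_integral_time_int (g : borelType E -> R) t : 0 <= t ->
  mu.-integrable setT (EFin \o g) -> (forall x, 0 <= g x) ->
  (\int[PP]_w (time_int g t w)%:E = t%:E * \int[mu]_x (g x)%:E)%E.
Proof.
move=> t0 /[dup] /measurable_int mg ig g0.
rewrite -(ge0_expectation_time_integral (F := EFin \o g))//.
apply: ae_eq_integral => //.
- by apply/measurable_EFinP; apply: measurable_time_int; exact/measurable_EFinP.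
- by apply: ge0_measurable_time_integral => // x; rewrite lee_fin.
- apply: filterS (integrable_path_ae t0 ig) => w igw _ /=.
  by rewrite fineK//; exact: integrable_fin_num.
Qed.

Lemma ge0_integrable_time_int (g : borelType E -> R) t : 0 <= t ->
  mu.-integrable setT (EFin \o g) -> (forall x, 0 <= g x) ->
  PP.-integrable setT (EFin \o (time_int g t : W -> R)).
Proof.
move=> t0 /[dup] /measurable_int /measurable_EFinP mg ig g0; apply/integrableP; split.
  by apply/measurable_EFinP; exact: measurable_time_int.
under eq_integral => w _.
  rewrite gee0_abs; last by rewrite lee_fin Rintegral_ge0.
  over.
rewrite ge0_integral_time_int// ltey_eq fin_numM//.
exact: integrable_fin_num.
Qed.

Lemma integrable_funrpos_setT (g : borelType E -> R) :
  mu.-integrable setT (EFin \o g) ->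
  mu.-integrable setT (EFin \o (fun x => Num.max (g x) 0)).
Proof.
move=> ig; apply: le_integrable (ig) => //.
  apply/measurable_EFinP; apply: measurable_maxr => //.
  by apply/measurable_EFinP; exact: measurable_int ig.
move=> x _ /=; rewrite lee_fin; case: (leP 0 (g x)) => g0.
  by rewrite !ger0_norm.
by rewrite normr0.
Qed.

(** The Tonelli identity concerns nonnegative functions, so [g] is split into [gp] and [gn];
    integrability is carried over to [time_int g] by almost sure equality. *)
Lemma Rintegral_time_int (g : borelType E -> R) t : 0 <= t ->
  mu.-integrable setT (EFin \o g) ->
  PP.-integrable setT (EFin \o (time_int g t : W -> R)) /\
  \int[PP]_w time_int g t w = t * \int[mu]_x g x.
Proof.
move=> t0 ig.
have iNg : mu.-integrable setT (EFin \o (fun x => - g x)).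
  by have := integrableN ig; exact: eq_integrable.
pose gp x := Num.max (g x) 0; pose gn x := Num.max (- g x) 0.
have igp : mu.-integrable setT (EFin \o gp) := integrable_funrpos_setT ig.
have ign : mu.-integrable setT (EFin \o gn) := integrable_funrpos_setT iNg.
have gp0 x : 0 <= gp x by rewrite le_max lexx orbT.
have gn0 x : 0 <= gn x by rewrite le_max lexx orbT.
have gE : g = (fun x => -1 * gn x + gp x).
  apply/funext => x; rewrite /gn /gp; case: (leP 0 (g x)) => gx.
    by rewrite max_r ?oppr_le0// mulr0 add0r.
  by rewrite max_l ?oppr_ge0 ?ltW// addr0 mulN1r opprK.
have itp := ge0_integrable_time_int t0 igp gp0.
have itn := ge0_integrable_time_int t0 ign gn0.
have tE : {ae PP, forall w, time_int g t w = -1 * time_int gn t w + time_int gp t w}.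
  by apply: filterS (time_int_lin_ae (-1) t0 ign igp) => w; rewrite -gE.
have mg : measurable_fun setT g.
  by apply/measurable_EFinP; exact: measurable_int ig.
have mt := measurable_time_int t mg.
have isum : PP.-integrable setT
    (EFin \o (fun w => -1 * time_int gn t w + time_int gp t w)).
  have := integrableD measurableT (integrableZl measurableT (-1) itn) itp.
  by apply: eq_integrable => // w _ /=; rewrite EFinD EFinM.
have it : PP.-integrable setT (EFin \o (time_int g t : W -> R)).
  apply/integrableP; split; first exact/measurable_EFinP.
  have /integrableP[ms] := isum; apply: le_lt_trans.
  rewrite le_eqVlt; apply/orP; left; apply/eqP; apply: ae_eq_integral => //.
  - by apply: measurableT_comp => //; exact/measurable_EFinP.
  - exact: measurableT_comp.
  - by apply: filterS tE => w tw _ /=; rewrite tw.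
split => //.
transitivity (\int[PP]_w (-1 * time_int gn t w + time_int gp t w)).
  congr fine; apply: ae_eq_integral => //.
  - exact/measurable_EFinP.
  - exact: measurable_int isum.
  - by apply: filterS tE => w tw _ /=; rewrite tw.
have iN : mu.-integrable setT (EFin \o (fun x => -1 * gn x)).
  by have := integrableZl measurableT (-1) ign; apply: eq_integrable => // x _ /=; rewrite EFinM.
have itN : PP.-integrable setT (EFin \o (fun w : W => -1 * time_int gn t w)).
  by have := integrableZl measurableT (-1) itn; apply: eq_integrable => // x _ /=; rewrite EFinM.
rewrite RintegralD// RintegralZl//.
rewrite {1 2}/Rintegral !ge0_integral_time_int//.
rewrite !fineM ?integrable_fin_num//.
rewrite [in RHS]gE RintegralD// RintegralZl// /Rintegral/=.
ring.
Qed.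

Lemma time_int_cst (c t : R) (w : W) : 0 <= t -> time_int (cst c) t w = t * c.
Proof.
move=> t0; have mD : measurable (`[0, t]%classic : set mR) by exact: measurable_itv.
transitivity (c * fine (leb (`[0, t]%classic : set mR))).
  exact: Rintegral_cst.
by rewrite lebesgue_measure_0t// mulrC.
Qed.

(** Cauchy-Schwarz in time, obtained by expanding the nonnegative integral of [(g(X_s) - m)^2] with
    [m] the time average. *)
Lemma time_int_sqr_ae (g : borelType E -> R) t : 0 < t ->
  mu.-integrable setT (EFin \o g) ->
  mu.-integrable setT (EFin \o (fun x => g x ^+ 2)) ->
  {ae PP, forall w, time_int g t w ^+ 2 <= t * time_int (fun x => g x ^+ 2) t w}.
Proof.
move=> t0 ig ig2.
apply: filterS2 (integrable_path_ae (ltW t0) ig) (integrable_path_ae (ltW t0) ig2).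
move=> w igw ig2w; set m := time_int g t w / t.
have mD : measurable (`[0, t]%classic : set mR) by exact: measurable_itv.
have icst c : leb.-integrable `[0, t] (EFin \o (fun _ : R => c)).
  apply/integrableP; split; first exact: measurable_cst.
  have -> : (\int[leb]_(x in `[0%R, t]) `|(EFin \o (fun=> c)) x|)%E =
      (`|c|%:E * leb (`[0%R, t]%classic : set mR))%E by exact: integral_cst.
  by rewrite lebesgue_measure_0t ?ltW// -EFinM ltry.
have ipart : leb.-integrable `[0, t] (EFin \o (fun s => -2 * m * g (path_at s w) + m ^+ 2)).
  have := integrableD mD (integrableZl mD (-2 * m) igw) (icst (m ^+ 2)).
  by apply: eq_integrable => // s _ /=; rewrite EFinD EFinM.
have ipart2 : leb.-integrable `[0, t] (EFin \o (fun s => -2 * m * g (path_at s w))).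
  have := integrableZl mD (-2 * m) igw.
  by apply: eq_integrable => // s _ /=; rewrite EFinM.
have : 0 <= \int[leb]_(s in `[0, t]) (g (path_at s w) - m) ^+ 2.
  by apply: Rintegral_ge0 => s _; exact: sqr_ge0.
have -> : \int[leb]_(s in `[0, t]) (g (path_at s w) - m) ^+ 2 =
    \int[leb]_(s in `[0, t]) (g (path_at s w) ^+ 2 + (-2 * m * g (path_at s w) + m ^+ 2)).
  by apply: eq_Rintegral => s _; ring.
rewrite RintegralD// RintegralD// RintegralZl//.
have -> : \int[leb]_(s in `[0, t]) m ^+ 2 = t * m ^+ 2.
  exact: (time_int_cst (m ^+ 2) w (ltW t0)).
rewrite -/(time_int g t w) -/(time_int (fun x => g x ^+ 2) t w).
have -> : time_int g t w = m * t by rewrite /m divfK ?gt_eqF.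
set Q := time_int _ t w => h.
have {}h : m ^+ 2 * t <= Q by nra.
by rewrite exprMn expr2 (expr2 t) -expr2 mulrA mulrC ler_pM2l.
Qed.

End time_integrals.

(** * Evaluations, time integrals and martingales as vectors of [L2(P)] *)

Section path_L2.
Context {R : realType} {E : pmetricType R}.
Local Notation W := (pathType (half_line R) E).
Variables (mu : probability (borelType E) R) (PP : probability W R).
Hypothesis PP_invariant : has_invariant_measure mu PP.
Implicit Types (f g : L2 mu).

(** As vectors of [L2(P)], path functionals inherit the triangle inequality and the scaling of
    [normL2]. The default value 0 of [toL2] is excluded for [0 <= s] by [evalL2E], and for [timeL2]
    with [0 < t] by [timeL2E]. *)
Definition evalL2 (s : R) f : L2 PP := toL2 PP (fun w => f (path_at s w)).

Definition timeL2 (t : R) g : L2 PP := toL2 PP (time_int g t).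

Let integral_eval s f : 0 <= s ->
  (\int[PP]_w (f (path_at s w) ^+ 2)%:E = (normL2 f ^+ 2)%:E)%E.
Proof.
move=> s0; rewrite -integral_sqr_L2.
apply: (ge0_integral_path_at PP_invariant (F := fun x => (f x ^+ 2)%:E)) => //.
  by apply/measurable_EFinP; apply: measurable_funX; exact: measurable_L2.
by move=> x; rewrite lee_fin sqr_ge0.
Qed.

Lemma evalL2E s f : 0 <= s -> evalL2 s f = (fun w => f (path_at s w)) :> (W -> R).
Proof.
move=> s0; apply: toL2E; apply: Lfun2_sqr_lty; last by rewrite integral_eval ?ltry.
by apply: measurableT_comp; [exact: measurable_L2|exact: measurable_path_at].
Qed.

Lemma normL2_eval s f : 0 <= s -> normL2 (evalL2 s f) = normL2 f.
Proof.
move=> s0; apply/eqP; rewrite -(@eqrXn2 _ 2) ?normL2_ge0//; apply/eqP/EFin_inj.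
rewrite -integral_sqr_L2 -(integral_eval f s0).
by apply: eq_integral => w _; rewrite evalL2E.
Qed.

Let integral_time t g : 0 < t ->
  (\int[PP]_w (time_int g t w ^+ 2)%:E <= ((t * normL2 g) ^+ 2)%:E)%E.
Proof.
move=> t0; have t0' := ltW t0.
have mg := measurable_L2 g.
have mg2 : measurable_fun setT (fun x => g x ^+ 2) by exact: measurable_funX.
have ig2 := integrable_sqr_L2 g.
apply: (@le_trans _ _ (\int[PP]_w (t%:E * (time_int (fun x => g x ^+ 2) t w)%:E)))%E.
  apply: ae_ge0_le_integral => //.
  - by move=> w _; rewrite lee_fin sqr_ge0.
  - by apply/measurable_EFinP; apply: measurable_funX; exact: measurable_time_int.
  - move=> w _; rewrite mule_ge0 ?lee_fin//; apply: Rintegral_ge0 => s _.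
    exact: sqr_ge0.
  - apply: measurable_funeM; apply/measurable_EFinP; exact: measurable_time_int.
  - apply: filterS (time_int_sqr_ae PP_invariant t0 (integrable_L2 g) ig2) => w h _.
    by rewrite -EFinM lee_fin.
rewrite ge0_integralZl_EFin//; last 2 first.
- move=> w _; rewrite lee_fin; apply: Rintegral_ge0 => s _; exact: sqr_ge0.
- by apply/measurable_EFinP; exact: measurable_time_int.
rewrite (ge0_integral_time_int PP_invariant t0' ig2); last by move=> x; exact: sqr_ge0.
by rewrite integral_sqr_L2 -!EFinM lee_fin exprMn expr2 mulrA.
Qed.

Lemma timeL2E t g : 0 < t -> timeL2 t g = time_int g t :> (W -> R).
Proof.
move=> t0; apply: toL2E; apply: Lfun2_sqr_lty.
  by apply: measurable_time_int; exact: measurable_L2.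
by apply: le_lt_trans (integral_time g t0) (ltry _).
Qed.

Lemma normL2_time t g : 0 < t -> normL2 (timeL2 t g) <= t * normL2 g.
Proof.
move=> t0; rewrite -ler_sqr ?nnegrE ?mulr_ge0 ?normL2_ge0 ?(ltW t0)//.
rewrite -lee_fin -integral_sqr_L2; apply: le_trans (integral_time g t0).
rewrite le_eqVlt; apply/orP; left; apply/eqP.
by apply: eq_integral => w _; rewrite timeL2E.
Qed.

Lemma timeL2_lin t (a : R) f g : 0 < t ->
  eqL2 (timeL2 t (a *: f + g)) (a *: timeL2 t f + timeL2 t g).
Proof.
move=> t0; apply: filterS (time_int_lin_ae PP_invariant a (ltW t0)
  (integrable_L2 f) (integrable_L2 g)) => w h _.
by rewrite L2_linE !timeL2E.
Qed.

Lemma timeL2D t f g : 0 < t ->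
  eqL2 (timeL2 t (f + g)) (timeL2 t f + timeL2 t g).
Proof. by move=> t0; have := timeL2_lin 1 f g t0; rewrite !scale1r. Qed.

Lemma timeL2_0 t : 0 < t -> eqL2 (timeL2 t 0) 0.
Proof.
move=> t0; apply/eqL2_normL2; rewrite subr0; apply/le_anti.
by rewrite normL2_ge0 andbT (le_trans (normL2_time _ t0))// normL2_0 mulr0.
Qed.

Lemma timeL2Z t a f : 0 < t -> eqL2 (timeL2 t (a *: f)) (a *: timeL2 t f).
Proof.
move=> t0; have := timeL2_lin a f 0 t0; rewrite addr0 => /eqL2_trans; apply.
by have := eqL2D (eqL2_refl (a *: timeL2 t f)) (timeL2_0 t0); rewrite addr0.
Qed.

Variable L : L2 mu -> L2 mu.

Definition martL2 (t : R) f : L2 PP := evalL2 t f - evalL2 0 f - timeL2 t (L f).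

Lemma martL2E t f : 0 < t -> martL2 t f = Mproc L f t :> (W -> R).
Proof.
move=> t0; apply/funext => w; rewrite /Mproc.
rewrite -(timeL2E (L f) t0); have -> : f (path_at t w) = evalL2 t f w.
  by rewrite evalL2E// ltW.
by have -> : f (path_at 0 w) = evalL2 0 f w by rewrite evalL2E.
Qed.

Lemma time_int0 (g : borelType E -> R) (w : W) : time_int g 0 w = 0.
Proof. by rewrite /time_int set_itv1; exact: Rintegral_set1. Qed.

(* [E N_t = E N_0 = 0] turns [E M_t^2] into the time integral of [2 Gamma], and
   [L (f^2)] has mean zero. *)
Lemma martL2_energy t f : 0 < t ->
  (f : E -> R) \* f \in Lfun mu 2%:E ->
  \int[mu]_x L (toL2 mu ((f : E -> R) \* f)) x = 0 ->
  martingale PP path_filtration (Nproc L f) ->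
  normL2 (martL2 t f) ^+ 2 = - (2 * t * inner (L f) f).
Proof.
move=> t0 f2L Lf2 mart; have t0' := ltW t0.
have f2E : (fun y => f y ^+ 2) = (f : E -> R) \* f.
  by apply/funext => y; rewrite expr2.
have iLf := integrable_mulL2 f (L f).
have iG : mu.-integrable setT (EFin \o Gamma L f).
  have := integrableD measurableT (integrableZl measurableT 2^-1
    (integrable_L2 (L (toL2 mu (fun y => f y ^+ 2))))) (integrableZl measurableT (-1) iLf).
  apply: eq_integrable => // x _ /=; rewrite /Gamma -!EFinM -EFinD; congr EFin.
  by field.
have GE : \int[mu]_x Gamma L f x = - inner f (L f).
  rewrite /Gamma; under eq_Rintegral => x _.
    rewrite mulrBr (_ : 2^-1 * (2 * f x * L f x) = f x * L f x); last by field.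
    over.
  rewrite RintegralB//; last first.
    have := integrableZl measurableT 2^-1
      (integrable_L2 (L (toL2 mu (fun y => f y ^+ 2)))).
    by apply: eq_integrable => // x _ /=; rewrite EFinM.
  rewrite RintegralZl//; last exact: integrable_L2.
  by rewrite f2E Lf2 mulr0 sub0r.
have [iTG TGE] := Rintegral_time_int PP_invariant t0' iG.
have [_ _ /(_ 0)] := mart t t0'.
rewrite lexx t0' => /(_ isT setT) mart0.
have {}mart0 : \int[PP]_w Nproc L f t w = 0.
  (* The martingale property is tested on the whole space, which is in the initial sigma-algebra as
     the complement of the empty set. *)
  rewrite mart0; last first.
    have [h0 hD _] := smallest_sigma_algebra setT (@cylinders R (half_line R) E
      [set s | \val s <= 0]).
    by have := hD _ h0; rewrite setD0.
  rewrite /Rintegral integral0_eq; first by [].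
  move=> w _; congr EFin.
  by rewrite /Nproc /Mproc !time_int0 subrr subr0 expr0n/= mulr0 subr0.
have iM : PP.-integrable setT (EFin \o (fun w => Mproc L f t w ^+ 2)).
  by rewrite -martL2E//; exact: integrable_sqr_L2.
have i2G : PP.-integrable setT (EFin \o (fun w : W => 2 * time_int (Gamma L f) t w)).
  have := integrableZl measurableT 2 iTG.
  by apply: eq_integrable => // w _ /=; rewrite EFinM.
move: mart0; rewrite /Nproc RintegralB// RintegralZl// TGE GE.
have -> : \int[PP]_w Mproc L f t w ^+ 2 = normL2 (martL2 t f) ^+ 2.
  rewrite normL2_sqr; apply: eq_Rintegral => w _; rewrite -(martL2E f t0).
  by rewrite expr2.
rewrite (innerC f) => h; lra.
Qed.

End path_L2.

(** * Time reversal *)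

Section time_reversal.
Context {R : realType} {E : pmetricType R}.
Local Notation W := (pathType (half_line R) E).
Variables (T : R) (T_ge0 : 0 <= T).

Lemma stop_subproof (s : set_type (half_line R)) : Num.min (\val s) T \in segment T.
Proof.
case: s => s /= /set_mem; rewrite /half_line/= in_itv/= andbT => s0.
by apply/mem_set; rewrite /segment/= in_itv/= le_min s0 T_ge0 ge_min lexx orbT.
Qed.

Definition stop (s : set_type (half_line R)) : set_type (segment T) :=
  exist (fun s => s \in segment T) _ (stop_subproof s).

Lemma continuous_stop : continuous stop.
Proof.
apply: (@continuous_comp_initial (set_type (segment T))
  (set_type (half_line R)) R set_val stop).
move=> x; apply: (@continuous_comp _ _ _ set_val (fun r => Num.min r T)).
  exact: (@initial_continuous (set_type (half_line R)) R set_val).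
by apply: (@continuous_min R R id (cst T)); [exact: cvg_id|exact: cst_continuous].
Qed.

HB.instance Definition _ := isContinuous.Build _ _ stop continuous_stop.


(** The path is frozen at its value at [T]. Reversal relates laws on the segment, whereas [Mproc]
    and [time_int] are functions of half-line paths; this map translates between the two. *)
Definition extend (v : pathType (segment T) E) : W :=
  ((v : continuousType (segment T) E) \o stop : continuousType _ _).

Lemma measurable_coordinate (I : set R) (s : I) :
  measurable_fun setT (fun w : pathType I E => (w : continuousType I E) s : borelType E).
Proof.
move=> _ B mB; rewrite setTI; apply: sub_sigma_algebra.
by exists s, B.
Qed.

Lemma measurable_extend : measurable_fun setT extend.
Proof. by apply: measurable_into_paths => s; exact: measurable_coordinate. Qed.

Lemma measurable_restr : measurable_fun setT (@restr R E T).
Proof. by apply: measurable_into_paths => s; exact: measurable_coordinate. Qed.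

Lemma measurable_reversal : measurable_fun setT (@reversal R E T).
Proof. by apply: measurable_into_paths => s; exact: measurable_coordinate. Qed.

Lemma path_at_extend_restr s (w : W) : 0 <= s <= T ->
  path_at s (extend (restr T w)) = path_at s w.
Proof.
move=> /andP[s0 sT]; rewrite /path_at; congr ((w : continuousType _ _) _).
by apply: val_inj => /=; rewrite max_r// min_l.
Qed.

Lemma path_at_extend_reversal s (w : W) : 0 <= s <= T ->
  path_at s (extend (reversal (restr T w))) = path_at (T - s) w.
Proof.
move=> /andP[s0 sT]; rewrite /path_at; congr ((w : continuousType _ _) _).
by apply: val_inj => /=; rewrite (max_r s0) min_l// max_r// subr_ge0.
Qed.

(** By the last premise [F] factors through [restr], so both sides are integrals of [F \o extend]
    against image measures on the segment, which [reversed_laws] identifies. *)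
Lemma integral_reversed_laws (PP PPhat : probability W R) (F : W -> \bar R) :
  reversed_laws PPhat PP -> measurable_fun setT F -> (forall w, 0 <= F w)%E ->
  (forall w, F (extend (restr T w)) = F w) ->
  (\int[PPhat]_w F w = \int[PP]_w F (extend (reversal (restr T w))))%E.
Proof.
move=> rev mF F0 FE; under [LHS]eq_integral do rewrite -FE.
have mFe := measurableT_comp mF measurable_extend.
have mrr := measurableT_comp measurable_reversal measurable_restr.
rewrite -[LHS](@ge0_integral_pushforward _ _ _ _ _ _ measurable_restr PPhat setT
  (F \o extend) measurableT mFe (fun x _ => F0 _)).
rewrite -[RHS](@ge0_integral_pushforward _ _ _ _ _ _ mrr PP setT
  (F \o extend) measurableT mFe (fun x _ => F0 _)).
apply: eq_measure_integral => [|m B mB _]; first exact: measurable_restr.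
exact: rev.
Qed.

End time_reversal.

Section forward_backward.
Context {R : realType} {E : pmetricType R}.
Local Notation W := (pathType (half_line R) E).
Variables (mu : probability (borelType E) R) (PP PPhat : probability W R).
Hypotheses (PP_invariant : has_invariant_measure mu PP)
  (PPhat_invariant : has_invariant_measure mu PPhat)
  (PP_reversed : reversed_laws PPhat PP).
Implicit Types (f g : L2 mu).

Lemma time_int_extend_restr (g : borelType E -> R) t (t0 : 0 <= t) (w : W) :
  time_int g t (extend t0 (restr t w)) = time_int g t w.
Proof.
apply: eq_Rintegral => s s_in; have st : 0 <= s <= t.
  by move: s_in; rewrite inE/= in_itv.
by rewrite path_at_extend_restr.
Qed.

Lemma time_int_extend_reversal (g : borelType E -> R) t (t0 : 0 <= t) (w : W) :
  measurable_fun setT g ->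
  time_int g t (extend t0 (reversal (restr t w))) = time_int g t w.
Proof.
move=> mg; rewrite [RHS]/time_int /Rintegral.
have mF : measurable_fun setT (fun s : R => (g (path_at s w))%:E).
  by apply/measurable_EFinP; exact: (measurable_path_compR w mg).
rewrite -(integral_reflection t mF); congr fine; apply: eq_integral => s s_in.
have st : 0 <= s <= t by move: s_in; rewrite inE/= in_itv.
by rewrite path_at_extend_reversal.
Qed.

Variable L : L2 mu -> L2 mu.

(** Reversal swaps the positions at times 0 and [t] and leaves the time integral unchanged, so the
    second moments agree. *)
Lemma normL2_reversed_mart t f : 0 < t ->
  normL2 (evalL2 PP 0 f - evalL2 PP t f - timeL2 PP t (L f)) =
  normL2 (martL2 PPhat L t f).
Proof.
move=> t0; apply/eqP; rewrite -(@eqrXn2 _ 2) ?normL2_ge0//; apply/eqP/EFin_inj.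
rewrite -!integral_sqr_L2; under [RHS]eq_integral do rewrite (martL2E PPhat_invariant)//.
have mM : measurable_fun setT (Mproc L f t : W -> R).
  by rewrite -(martL2E PPhat_invariant)//; exact: measurable_L2.
have mLf := measurable_L2 (L f); have t0' := ltW t0.
rewrite (integral_reversed_laws (T_ge0 := t0') (F := fun w => (Mproc L f t w ^+ 2)%:E)
  PP_reversed).
- apply: eq_integral => w _; congr (_ ^+ 2)%:E; rewrite /Mproc.
  rewrite time_int_extend_reversal// !path_at_extend_reversal ?lexx ?t0'//.
  rewrite subrr subr0.
  have -> : time_int (L f) t w = timeL2 PP t (L f) w by rewrite timeL2E.
  have -> : f (path_at 0 w) = evalL2 PP 0 f w by rewrite evalL2E.
  by have -> : f (path_at t w) = evalL2 PP t f w by rewrite evalL2E.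
- by apply/measurable_EFinP; exact: measurable_funX.
- by move=> w; rewrite lee_fin sqr_ge0.
- move=> w; rewrite /Mproc time_int_extend_restr.
  by rewrite !path_at_extend_restr ?lexx ?t0'.
Qed.

End forward_backward.

(** * Martingale estimates for [L] and [Lhat], and the final bound *)

Theorem theorem2p6 (R : realType) (E : pmetricType R)
    (hE : separable_space E)
    (mu : probability (borelType E) R)
    (* analytic setting *)
    (D : set (L2 mu)) (S A : L2 mu -> L2 mu)
    (D_subspace : linear_subspace D)
    (D_dense : dense_in setT D)
    (D_algebra : subalgebra D)
    (S_linear : linear_on D S)
    (S_symmetric : forall f g, D f -> D g -> inner (S f) g = inner f (S g))
    (S_nonpos : forall f, D f -> inner (S f) f <= 0)
    (A_linear : linear_on D A)
    (A_antisymmetric :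
      forall f g, D f -> D g -> inner (A f) g = - inner f (A g)) :
  let L : L2 mu -> L2 mu := fun f => S f - A f in
  let Lhat : L2 mu -> L2 mu := fun f => S f + A f in
  forall (mu_invariant : forall f, D f ->
      \int[mu]_x L f x = 0 /\ \int[mu]_x Lhat f x = 0)
    (L_closable : closable (oper D L))
    (Lhat_closable : closable (oper D Lhat))
    (S_closable : closable (oper D S))
    (A_closable : closable (oper D A)),
  let clL := closure_op (oper D L) in
  let clS := closure_op (oper D S) in
  let clA := closure_op (oper D A) in
  forall (P : L2 mu -> L2 mu) (P_proj : is_orth_proj (op_ker clS) P)
    (* stochastic setting *)
    (PP PPhat : probability (pathType (half_line R) E) R)
    (PP_invariant : has_invariant_measure mu PP)
    (PPhat_invariant : has_invariant_measure mu PPhat)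
    (PP_reversed : reversed_laws PPhat PP)
    (PP_martingale : forall f, D f ->
      martingale PP path_filtration (Nproc L f))
    (PPhat_martingale : forall f, D f ->
      martingale PPhat path_filtration (Nproc Lhat f)),
  (* operators on DP = P(D); P f = f for f in DP, so composing with P agrees
     with the definition through representatives f = P g *)
  let DP := imageL2 P D in
  let HP := imageL2 P setT in
  let opP := oper setT P in
  let AP := op_comp clA opP in
  let G := op_restr DP (op_comp opP (op_comp clA AP)) in
  let LAP := op_restr DP (op_comp clL AP) in
  let APD := op_image AP DP in
  forall (Lambda_m Lambda_M c1 c2 c3 : R)
    (E1_selfadjoint : essentially_selfadjoint_in setT (oper D S))
    (Lambda_m_gt0 : 0 < Lambda_m)
    (E1_coercive : forall f, D f ->
      Lambda_m * normL2 (f - P f) ^+ 2 <= - inner (S f) f)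
    (E2_domA : DP `<=` op_dom clA)
    (E2_domAP : APD `<=` op_dom clA `&` op_dom clS `&` op_dom clL)
    (E2_L : forall f g h k, APD f -> clL f g -> clS f h -> clA f k ->
      eqL2 g (h - k))
    (c1_ge0 : 0 <= c1) (c2_ge0 : 0 <= c2)
    (E2_bound : forall f g h, DP f -> LAP f g -> G f h ->
      normL2 g <= c1 * normL2 h + c2 * normL2 f)
    (E3_selfadjoint : essentially_selfadjoint_in HP G)
    (Lambda_M_gt0 : 0 < Lambda_M)
    (E3_coercive : forall f g, DP f -> G f g ->
      Lambda_M * normL2 (f - inner f (oneL2 mu) *: oneL2 mu) ^+ 2
        <= - inner g f)
    (E3_one : HP (oneL2 mu) /\ closure_op G (oneL2 mu) 0)
    (c3_ge0 : 0 <= c3)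
    (E4 : forall f g h k, DP f -> AP f g -> clS g h -> G f k ->
      inner h g = c3 * inner k f)
    (f : L2 mu) (t : R) (t_gt0 : 0 < t),
  let kappa1 : R := Num.sqrt 2 / Num.sqrt Lambda_M in
  let kappa2 : R := (c1 + 1) / Num.sqrt Lambda_m
                + c2 / (Num.sqrt Lambda_m * Lambda_M)
                + Num.sqrt c3 / Num.sqrt Lambda_M in
  let Ef := \int[mu]_x f x in
  ('N[PP]_2%:E[EFin \o (fun w => t^-1 * time_int f t w - Ef)%R]
   <= (Num.sqrt 2 * (t^-1 * kappa1 + (Num.sqrt t)^-1 * kappa2))%:E
      * 'N[PP]_2%:E[EFin \o (fun w => f (path_at 0 w) - Ef)%R])%E.
Proof.
move=> L Lhat mu_invariant _ _ _ _ clL clS clA P P_proj PP PPhat PP_invariant.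
move=> PPhat_invariant PP_reversed PP_martingale PPhat_martingale.
move=> DP HP opP AP G LAP APD Lambda_m Lambda_M c1 c2 c3.
move=> E1_selfadjoint Lambda_m_gt0 E1_coercive _ E2_domAP E2_L c1_ge0 c2_ge0.
move=> E2_bound E3_selfadjoint Lambda_M_gt0 E3_coercive E3_one c3_ge0 E4.
move=> f t t_gt0; cbv zeta.
set kappa1 : R := Num.sqrt 2 / Num.sqrt Lambda_M.
set kappa2 : R := (c1 + 1) / Num.sqrt Lambda_m + c2 / (Num.sqrt Lambda_m * Lambda_M)
  + Num.sqrt c3 / Num.sqrt Lambda_M.
set Ef := \int[mu]_x f x.
have t_ge0 := ltW t_gt0.
pose p (g : L2 mu) := normL2 (timeL2 PP t g).
(* Thus [L], [Lhat] and [S] have the same energy on [D], and the forward and backward martingales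
   have equal norm. *)
have Aff g : D g -> inner (A g) g = 0.
  by move=> Dg; have := A_antisymmetric _ _ Dg Dg; rewrite (innerC g) => h; lra.
have energy (L' : L2 mu -> L2 mu) (Q : probability (pathType (half_line R) E) R) g :
    has_invariant_measure mu Q -> D g ->
    (forall h, D h -> \int[mu]_x L' h x = 0) ->
    inner (L' g) g = inner (S g) g -> martingale Q path_filtration (Nproc L' g) ->
    normL2 (martL2 Q L' t g) = Num.sqrt (2 * t) * Num.sqrt (- inner (S g) g).
  move=> Qinv Dg L'0 L'S mart; have [g2 Dg2] := D_algebra _ _ Dg Dg.
  rewrite -sqrtrM ?mulr_ge0// mulrN -L'S.
  rewrite -(martL2_energy Qinv t_gt0 g2 (L'0 _ Dg2) mart).
  by rewrite sqrtr_sqr ger0_norm// normL2_ge0.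
have Mnorm g : D g ->
    normL2 (martL2 PP L t g) = Num.sqrt (2 * t) * Num.sqrt (- inner (S g) g).
  move=> Dg; refine (energy L PP g PP_invariant Dg _ _ (PP_martingale _ Dg)).
    by move=> h /mu_invariant[].
  by rewrite /L innerBl (Aff _ Dg) subr0.
have Mhatnorm g : D g ->
    normL2 (evalL2 PP 0 g - evalL2 PP t g - timeL2 PP t (Lhat g)) =
    Num.sqrt (2 * t) * Num.sqrt (- inner (S g) g).
  move=> Dg; rewrite (normL2_reversed_mart PP_invariant PPhat_invariant PP_reversed _ _ t_gt0).
  refine (energy Lhat PPhat g PPhat_invariant Dg _ _ (PPhat_martingale _ Dg)).
    by move=> h /mu_invariant[].
  by rewrite /Lhat innerDl (Aff _ Dg) addr0.
have pD g h : p (g + h) <= p g + p h.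
  by rewrite /p (eq_normL2 (timeL2D PP_invariant g h t_gt0)) normL2D.
have pN g : p (- g) = p g.
  rewrite /p -scaleN1r (eq_normL2 (timeL2Z PP_invariant (-1) g t_gt0)).
  by rewrite normL2Z normrN1 mul1r.
have p_le g : p g <= t * normL2 g by exact: normL2_time.
(* The forward martingale plus the reversed backward one is -2 times the time
   integral of S g: the boundary terms cancel. *)
have pS g : D g -> p (S g) <= Num.sqrt (2 * t) * Num.sqrt (- inner (S g) g).
  move=> Dg.
  have LL : L g + Lhat g = 2 *: S g.
    by rewrite /L /Lhat addrACA addNr addr0; exact: esym (scaler_nat 2 (S g)).
  have := timeL2D PP_invariant (L g) (Lhat g) t_gt0; rewrite LL => JD.
  have := eqL2_trans (eqL2_sym (timeL2Z PP_invariant 2 (S g) t_gt0)) JD.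
  move=> /eq_normL2; rewrite normL2Z ger0_norm// -(normL2N (timeL2 PP t (L g) + _)).
  have -> : - (timeL2 PP t (L g) + timeL2 PP t (Lhat g)) =
      martL2 PP L t g + (evalL2 PP 0 g - evalL2 PP t g - timeL2 PP t (Lhat g)).
    by rewrite /martL2 addrACA -(opprB (evalL2 PP 0 g)) addNr add0r opprD.
  move=> h; have := normL2D (martL2 PP L t g)
    (evalL2 PP 0 g - evalL2 PP t g - timeL2 PP t (Lhat g)).
  rewrite -h Mnorm// Mhatnorm// /p; lra.
have pL g : D g ->
    p (L g) <= 2 * normL2 g + Num.sqrt (2 * t) * Num.sqrt (- inner (S g) g).
  move=> Dg; rewrite /p.
  (* Here the two boundary terms stay; by invariance each has norm [|g|]. *)
  have -> : timeL2 PP t (L g) = evalL2 PP t g - evalL2 PP 0 g - martL2 PP L t g.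
    by rewrite /martL2 opprB addrC subrK.
  apply: le_trans (normL2D _ _) _; rewrite normL2N Mnorm// lerD2r.
  apply: le_trans (normL2D _ _) _; rewrite normL2N !(normL2_eval PP_invariant)//.
  by rewrite mulr2n mulrDl !mul1r.
have EfE : Ef = inner f (oneL2 mu) by exact: Rintegral_L2.
(* The time average of the constant [Ef] is [Ef] itself, so both norms in the conclusion can be
   expressed through the centred [f0]. *)
pose f0 := (- Ef) *: oneL2 mu + f.
have f0_one : inner f0 (oneL2 mu) = 0.
  by rewrite /f0 inner_linl inner_one_one EfE mulr1 addNr.
have := @seminorm_centered _ _ _ mu p t pD pN p_le D S A D_subspace S_linear
  A_linear A_antisymmetric pS pL P P_proj Lambda_m E1_selfadjoint Lambda_m_gt0
  E1_coercive Lambda_M c1 c2 c3 E2_domAP E2_L c1_ge0 c2_ge0 E2_bound E3_selfadjoint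
  Lambda_M_gt0 E3_coercive E3_one c3_ge0 E4 f0 f0_one.
rewrite -/kappa2 => bound.
have lhsE : 'N[PP]_2%:E[EFin \o (fun w => t^-1 * time_int f t w - Ef)%R]%E =
    (t^-1 * p f0)%:E.
  have -> : (fun w => t^-1 * time_int f t w - Ef) =
      (t^-1 *: timeL2 PP t f + (- Ef) *: oneL2 PP : L2 PP) :> (_ -> R).
    apply/funext => w.
    change (t^-1 * time_int f t w - Ef =
      t^-1 * timeL2 PP t f w + (- Ef) * oneL2 PP w).
    by rewrite oneL2E mulr1 timeL2E.
  rewrite -finite_norm_fine -/(normL2 _); congr EFin.
  rewrite /p -[t^-1 in RHS]ger0_norm ?invr_ge0// -normL2Z; apply: eq_normL2.
  have h1 := timeL2_lin PP_invariant (- Ef) (oneL2 mu) f t_gt0.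
  apply: eqL2_sym; apply: eqL2_trans (eqL2Z t^-1 h1) _.
  apply: filterE => w _.
  change (t^-1 * (- Ef * timeL2 PP t (oneL2 mu) w + timeL2 PP t f w) =
    t^-1 * timeL2 PP t f w + (- Ef) * oneL2 PP w).
  rewrite oneL2E mulr1 (timeL2E PP_invariant (oneL2 mu))//.
  have -> : time_int (oneL2 mu) t w = t.
    rewrite -[RHS]mulr1 -(time_int_cst 1 w)//; apply: eq_Rintegral => s _.
    by rewrite oneL2E.
  by rewrite mulrDr mulrA mulrN mulNr -mulrA mulrCA mulVf ?gt_eqF// mulr1 addrC.
have rhsE : 'N[PP]_2%:E[EFin \o (fun w => f (path_at 0 w) - Ef)%R]%E =
    (normL2 f0)%:E.
  have -> : (fun w => f (path_at 0 w) - Ef) = evalL2 PP 0 f0 :> (_ -> R).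
    apply/funext => w; rewrite evalL2E//.
    change (f (path_at 0 w) - Ef = - Ef * oneL2 mu (path_at 0 w) + f (path_at 0 w)).
    by rewrite oneL2E mulr1 addrC.
  by rewrite -finite_norm_fine -/(normL2 _) normL2_eval.
rewrite lhsE rhsE -EFinM lee_fin.
apply: le_trans (ler_wpM2l _ bound) _; first by rewrite invr_ge0.
rewrite mulrA ler_wpM2r ?normL2_ge0// le_eqVlt; apply/orP; left; apply/eqP.
(* The 2 of the boundary terms is [sqrt 2 * sqrt 2], one factor in front and one in [kappa1]; the
   other term uses [sqrt (2 t) / t = sqrt 2 / sqrt t]. *)
rewrite /kappa1 sqrtrM//.
set s2 := Num.sqrt 2; set st := Num.sqrt t; set sM := Num.sqrt Lambda_M.
have s22 : s2 ^+ 2 = 2 by rewrite sqr_sqrtr.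
have stt : st ^+ 2 = t by rewrite sqr_sqrtr.
have st0 : st != 0 by rewrite gt_eqF// sqrtr_gt0.
have sM0 : sM != 0 by rewrite gt_eqF// sqrtr_gt0.
rewrite -stt -[2 / sM]/(2 * sM^-1) -{1}s22; field.
by rewrite st0.
Qed.
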